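(* Let $n>3$ and consider the complex Poisson algebras with basis $e_1,\dots,e_n$: $\mathcal{P}_0^n$ with only nonzero products $e_i\cdot e_j=e_{i+j}$ for $2\le i+j\le n$ and zero bracket; and, with $e_i\cdot e_j=e_{i+j}$ for $2\le i+j\le n-1$ plus the listed further nonzero products (up to commutativity/anticommutativity): $\mathcal{P}_{1,1}^n$: none; $\mathcal{P}_{1,2}^n$: $\{e_1,e_n\}=e_n$; $\mathcal{P}_{1,3}^n$: $\{e_1,e_n\}=e_{n-1}$; $\mathcal{P}_{1,4}^n$: $e_n\cdot e_n=e_{n-1}$; $\mathcal{P}_{1,5}^n$: $e_n\cdot e_n=e_{n-1}$, $\{e_1,e_n\}=e_{n-1}$. Their orbits in $\mathbf{P}_n$ have dimension $n^2-n$ for $\mathcal{P}_0^n,\mathcal{P}_{1,2}^n,\mathcal{P}_{1,5}^n$, $n^2-n-1$ for $\mathcal{P}_{1,3}^n,\mathcal{P}_{1,4}^n$, and $n^2-n-2$ for $\mathcal{P}_{1,1}^n$. The primary degenerations among these six algebras are exactly $\mathcal{P}_{1,2}^n\to\mathcal{P}_{1,3}^n$, $\mathcal{P}_{1,5}^n\to\mathcal{P}_{1,3}^n$, $\mathcal{P}_{1,5}^n\to\mathcal{P}_{1,4}^n$, $\mathcal{P}_0^n\to\mathcal{P}_{1,4}^n$, $\mathcal{P}_{1,3}^n\to\mathcal{P}_{1,1}^n$, $\mathcal{P}_{1,4}^n\to\mathcal{P}_{1,1}^n$; moreover $\mathcal{P}_0^n\not\to\mathcal{P}_{1,3}^n$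 and $\mathcal{P}_{1,2}^n\not\to\mathcal{P}_{1,4}^n$, and for two distinct algebras $\mathcal{A},\mathcal{B}$ among these six, $\mathcal{A}\to\mathcal{B}$ if and only if there is a chain of the listed primary degenerations from $\mathcal{A}$ to $\mathcal{B}$.
   Context: Fix an $n$-dimensional complex vector space $V$; pairs $(\mu,\mu')$ of bilinear maps on $V$ are identified with their structure constants in $\mathbb{C}^{2n^3}$, and $\mathbf{P}_n$ is the variety of pairs defining Poisson algebras ($\mu$ commutative associative, $\mu'$ Lie, $\mu'(\mu(x,y),z)=\mu(\mu'(x,z),y)+\mu(x,\mu'(y,z))$). $\mathrm{GL}(V)$ acts by $(g*(\mu,\mu'))(x,y)=(g\mu(g^{-1}x,g^{-1}y),g\mu'(g^{-1}x,g^{-1}y))$. $\mathcal{P}\to\mathcal{P}'$ means a structure representing $\mathcal{P}'$ lies in the Zariski closure of the orbit of a structure representing $\mathcal{P}$; $\not\to$ denotes its negation; a degeneration is primary if it is proper ($\mathcal{P}\not\cong\mathcal{P}'$) and does not factor as two proper degenerations through some $\mathcal{P}''$. *)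

(* Defs.v *)
From mathcomp Require Import all_boot all_algebra.
From mathcomp Require Import reals Rstruct.
From mathcomp.real_closed Require Import complex.
From mathcomp Require Import mpoly.
From Stdlib Require Import Relations.

Set Implicit Arguments.
Unset Strict Implicit.
Unset Printing Implicit Defensive.
Import GRing.Theory.
Local Open Scope ring_scope.

Definition C : closedFieldType := (Rdefinitions.R)[i].

(* index set of the structure constants of a pair (mu, mu') on V = C^n:
   (false, i, j, k) is the coefficient of e_k in mu(e_i, e_j),
   (true,  i, j, k) is the coefficient of e_k in mu'(e_i, e_j).
   It has 2 n^3 elements. *)
Definition sidx (n : nat) : finType := (bool * 'I_n * 'I_n * 'I_n)%type.

Definition pstruct (n : nat) := sidx n -> C.

Definition bil n (s : pstruct n) (b : bool) (x y : 'cV[C]_n) : 'cV[C]_n :=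
  \col_k \sum_i \sum_j x i 0 * y j 0 * s (b, i, j, k).

Definition pmu n (s : pstruct n) := bil s false.
Definition pbr n (s : pstruct n) := bil s true.

Definition is_poisson n (s : pstruct n) : Prop :=
  [/\ (forall x y, pmu s x y = pmu s y x),
      (forall x y z, pmu s (pmu s x y) z = pmu s x (pmu s y z)),
      (forall x, pbr s x x = 0),
      (forall x y z, pbr s x (pbr s y z) + pbr s y (pbr s z x)
                     + pbr s z (pbr s x y) = 0)
    & (forall x y z, pbr s (pmu s x y) z
                     = pmu s (pbr s x z) y + pmu s x (pbr s y z))].

Definition ebas n (i : 'I_n) : 'cV[C]_n := delta_mx i 0.

Definition act n (g : 'M[C]_n) (s : pstruct n) : pstruct n :=
  fun t => let: (b, i, j, k) := t in
    (g *m bil s b (invmx g *m ebas i) (invmx g *m ebas j)) k 0.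

Definition gorbit n (s : pstruct n) : pstruct n -> Prop :=
  fun t => exists2 g : 'M[C]_n, g \in unitmx & t = act g s.

Definition iso n (s t : pstruct n) : Prop := gorbit s t.

Definition coords n (s : pstruct n) : 'I_#|sidx n| -> C :=
  fun m => s (enum_val m).

Notation polyC n := {mpoly C[#|sidx n|]}.

Definition zclosure n (S : pstruct n -> Prop) : pstruct n -> Prop :=
  fun t => forall p : polyC n,
    (forall u, S u -> p.@[coords u] = 0) -> p.@[coords t] = 0.

Definition zclosed n (Z : pstruct n -> Prop) : Prop :=
  exists P : polyC n -> Prop,
    forall t, Z t <-> (forall p, P p -> p.@[coords t] = 0).

Definition zsubset n (A B : pstruct n -> Prop) := forall t, A t -> B t.

Definition zirreducible n (Z : pstruct n -> Prop) : Prop :=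
  [/\ zclosed Z, (exists t, Z t) &
      forall Z1 Z2, zclosed Z1 -> zclosed Z2 ->
        zsubset Z (fun t => Z1 t \/ Z2 t) -> zsubset Z Z1 \/ zsubset Z Z2].

Definition irr_chain n (A : pstruct n -> Prop) (Z : nat -> pstruct n -> Prop)
    (k : nat) : Prop :=
  (forall i, (i <= k)%N -> zirreducible (Z i) /\ zsubset (Z i) A) /\
  (forall i, (i < k)%N ->
     zsubset (Z i) (Z i.+1) /\ ~ zsubset (Z i.+1) (Z i)).

Definition has_dim n (S : pstruct n -> Prop) (d : nat) : Prop :=
  (exists Z, irr_chain (zclosure S) Z d) /\
  ~ (exists Z, irr_chain (zclosure S) Z d.+1).

Definition degen n (s t : pstruct n) : Prop :=
  exists s' t', [/\ iso s s', iso t t' & zclosure (gorbit s') t'].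

Definition primary n (s t : pstruct n) : Prop :=
  [/\ degen s t, ~ iso s t &
      ~ (exists u, [/\ is_poisson u, degen s u, ~ iso s u,
                       degen u t & ~ iso u t])].

(* The six algebras.  Structure constants given with 1-based indices:
   m i j k = coefficient of e_k in e_i . e_j, l i j k = coefficient of e_k
   in {e_i, e_j}. *)
Definition alg_of n (m l : nat -> nat -> nat -> C) : pstruct n :=
  fun t => let: (b, i, j, k) := t in
    if b then l i.+1 j.+1 k.+1 else m i.+1 j.+1 k.+1.

Arguments alg_of n m l : clear implicits.

Inductive alg := P0 | P11 | P12 | P13 | P14 | P15.

Definition kd (a b : nat) : C := (a == b)%:R.

Definition filprod (N : nat) : nat -> nat -> nat -> C :=
  fun i j k => ((i + j == k) && (i + j <= N)%N)%:R.

Definition palg (n : nat) (A : alg) : pstruct n :=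
  match A with
  | P0 => alg_of n (filprod n) (fun _ _ _ => 0)
  | P11 => alg_of n (filprod n.-1) (fun _ _ _ => 0)
  | P12 => alg_of n (filprod n.-1)
      (fun i j k => kd i 1 * kd j n * kd k n - kd i n * kd j 1 * kd k n)
  | P13 => alg_of n (filprod n.-1)
      (fun i j k => kd i 1 * kd j n * kd k n.-1 - kd i n * kd j 1 * kd k n.-1)
  | P14 => alg_of n
      (fun i j k => filprod n.-1 i j k + kd i n * kd j n * kd k n.-1)
      (fun _ _ _ => 0)
  | P15 => alg_of n
      (fun i j k => filprod n.-1 i j k + kd i n * kd j n * kd k n.-1)
      (fun i j k => kd i 1 * kd j n * kd k n.-1 - kd i n * kd j 1 * kd k n.-1)
  end.

Definition listed (A B : alg) : Prop :=
  match A, B with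
  | P12, P13 | P15, P13 | P15, P14 | P0, P14 | P13, P11 | P14, P11 => True
  | _, _ => False
  end.

Arguments palg n A : clear implicits.

(* Main.v *)
(** Each of the six structures is recognized by elements satisfying relations: a
    nilpotent Poisson structure with [v^n <> 0] is null-filiform, while one with
    [v^n = 0] for which [v, ..., v^(n-1)], [y] is a basis can be normalized so that
    [v y = 0], [y y = al v^(n-1)], [{v, y} = ga v^(n-1) + de y] with [al de = 0].
    Hence any structure between two of the six algebras is isomorphic to one of
    the six, and primary degenerations are the covering relations of the order.
    Degenerations come from letting [(al, ga, de)] move on a line, and from an
    explicit polynomial curve for [P0 -> P14]. Non-degenerations come from four
    closed conditions: zero bracket, [{x, {x, y}} = 0], [x^(n-1) y = 0], and corank
    at least 2 of all the forms [f (x y)].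

    For dimensions, a chain of [k] strict inclusions of irreducible closed sets
    gives [k] algebraically independent functions, which is impossible on a set
    with a dense part parametrized by fewer than [k] parameters; the normal form
    above gives such parametrizations for P0, P12 and P15. In the closure of the
    orbit of P11 a chain is obtained by freeing the entries of the acting matrix
    one at a time. The strict inclusions between orbit closures do the rest. *)

Require Import Defs.
From mathcomp Require Import all_boot all_algebra.
From mathcomp Require Import Rstruct.
From mathcomp.real_closed Require Import complex.
From mathcomp Require Import mpoly ring zify.
From Stdlib Require Import Relations Classical FunctionalExtensionality.

Set Implicit Arguments.
Unset Strict Implicit.
Unset Printing Implicit Defensive.
Import GRing.Theory.
Local Open Scope ring_scope.

(** Dimension is the length of chains of irreducible closed sets, so both bounds are statements
    about chains and no stabilizer is computed. The counts come out exact because on a dense part of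
    each orbit [v = e_1] works, and outside [P0] so does [y = e_n]. The first column of the acting
    matrix is then prescribed, and what remains is: for [P0], the n (n - 1) coordinates of v^2, ...,
    v^n; for [P12] and [P15], the n (n - 2) coordinates of v^2, ..., v^(n-1), the n - 2 coefficients
    of the shift of [y] and 2 structure constants, again n (n - 1). In the orbit closure of [P11], n
    (n - 2) + (n - 2) = n^2 - n - 2 matrix entries can be read off from the structure. Two strict
    inclusions lead from [P11] to each of the three maximal algebras and each costs one dimension,
    so the bounds meet at every algebra. The condition n > 3 shows up in the normalization of [P15],
    which extracts a root of order n - 3. *)

Lemma natC_eq0 (k : nat) : ((k%:R : C) == 0) = (k == 0%N).
Proof. exact: (@Num.Theory.pnatr_eq0 ((Rdefinitions.R)[i] : numDomainType)). Qed.

Lemma natC_inj : injective (fun k : nat => k%:R : C).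
Proof. exact: (@Num.Theory.mulrIn ((Rdefinitions.R)[i] : numDomainType) 1 (oner_neq0 _)). Qed.

Lemma poly_eq0_nat (p : {poly C}) (m : nat) :
  (size p <= m)%N -> (forall k, (k < m)%N -> p.[k%:R] = 0) -> p = 0.
Proof.
move=> szp p0; apply: (@roots_geq_poly_eq0 _ _ [seq k%:R | k <- iota 0 m]).
- by apply/allP => x /mapP[k + ->]; rewrite mem_iota => lt_km; apply/rootP/p0; case/andP: lt_km.
- by rewrite map_inj_uniq ?iota_uniq //; exact: natC_inj.
- by rewrite size_map size_iota.
Qed.

(** * Functions on affine space that are polynomial in each coordinate *)

Definition upd (I : finType) (x : {ffun I -> C}) (i : I) (t : C) : {ffun I -> C} :=
  [ffun j => if j == i then t else x j].

Lemma upd_id (I : finType) (x : {ffun I -> C}) i : upd x i (x i) = x.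
Proof. by apply/ffunP => j; rewrite ffunE; case: eqP => // ->. Qed.

(** Polynomial of degree at most [M] in each coordinate when the others are frozen. The uniform
    bound makes vanishing testable on the finite grid of integers [0, ..., M]. *)
Definition pfun (I : finType) (M : nat) (F : {ffun I -> C} -> C) :=
  forall x i, exists2 p : {poly C},
    (size p <= M.+1)%N & forall t, F (upd x i t) = p.[t].

Definition polyfun (I : finType) (F : {ffun I -> C} -> C) := exists M, pfun M F.

Section PolyFun.
Variable I : finType.
Implicit Types (F G : {ffun I -> C} -> C) (x : {ffun I -> C}).

Lemma pfun_le M M' F : (M <= M')%N -> pfun M F -> pfun M' F.
Proof.
by move=> le_M pF x i; have [p sp pE] := pF x i; exists p => //; apply: leq_trans sp _.
Qed.

Lemma eq_pfun M F G : F =1 G -> pfun M F -> pfun M G.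
Proof.
by move=> eFG pF x i; have [p sp pE] := pF x i; exists p => // t; rewrite -eFG.
Qed.

Lemma pfun_const M (c : C) : pfun M (fun _ : {ffun I -> C} => c).
Proof.
move=> x i; exists c%:P; last by move=> t; rewrite hornerC.
by rewrite (leq_trans (size_polyC_leq1 c)).
Qed.

Lemma pfun_coord i : pfun 1 (fun x : {ffun I -> C} => x i).
Proof.
move=> x j; case: (eqVneq i j) => [->|ne].
  by exists 'X; rewrite ?size_polyX // => t; rewrite ffunE eqxx hornerX.
exists (x i)%:P; first by rewrite (leq_trans (size_polyC_leq1 _)).
by move=> t; rewrite ffunE (negbTE ne) hornerC.
Qed.

Lemma pfunD M F G : pfun M F -> pfun M G -> pfun M (fun x => F x + G x).
Proof.
move=> pF pG x i; have [p sp pE] := pF x i; have [q sq qE] := pG x i.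
exists (p + q); last by move=> t; rewrite hornerD pE qE.
by rewrite (leq_trans (size_polyD _ _)) // geq_max sp.
Qed.

Lemma pfunM M M' F G : pfun M F -> pfun M' G -> pfun (M + M') (fun x => F x * G x).
Proof.
move=> pF pG x i; have [p sp pE] := pF x i; have [q sq qE] := pG x i.
exists (p * q); last by move=> t; rewrite hornerM pE qE.
by rewrite (leq_trans (size_polyMleq _ _)) //; lia.
Qed.

Lemma pfunX M k F : pfun M F -> pfun (k * M) (fun x => F x ^+ k).
Proof.
move=> pF; elim: k => [|k IHk]; first exact: pfun_const.
rewrite mulSn; apply: eq_pfun (pfunM pF IHk) => x.
by rewrite exprS.
Qed.

Lemma pfun_sum M (J : finType) (F : J -> {ffun I -> C} -> C) :
  (forall j, pfun M (F j)) -> pfun M (fun x => \sum_j F j x).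
Proof.
move=> pF; elim: (index_enum J) => [|j r IHr].
  by apply: eq_pfun (pfun_const _ 0) => x; rewrite big_nil.
by apply: eq_pfun (pfunD (pF j) IHr) => x; rewrite big_cons.
Qed.

Lemma eq_polyfun F G : F =1 G -> polyfun F -> polyfun G.
Proof. by move=> eFG [M /(eq_pfun eFG) pG]; exists M. Qed.

Lemma polyfun_const (c : C) : polyfun (fun _ : {ffun I -> C} => c).
Proof. by exists 0%N; apply: pfun_const. Qed.

Lemma polyfun_coord i : polyfun (fun x : {ffun I -> C} => x i).
Proof. by exists 1%N; apply: pfun_coord. Qed.

Lemma polyfunD F G : polyfun F -> polyfun G -> polyfun (fun x => F x + G x).
Proof.
move=> [M pF] [M' pG]; exists (M + M')%N.
by apply: pfunD; [apply: pfun_le pF|apply: pfun_le pG]; lia.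
Qed.

Lemma polyfunM F G : polyfun F -> polyfun G -> polyfun (fun x => F x * G x).
Proof. by move=> [M pF] [M' pG]; exists (M + M')%N; apply: pfunM. Qed.

Lemma polyfunN F : polyfun F -> polyfun (fun x => - F x).
Proof. by move=> pF; apply: eq_polyfun (polyfunM (polyfun_const (-1)) pF) => x; rewrite mulN1r. Qed.

Lemma polyfunX k F : polyfun F -> polyfun (fun x => F x ^+ k).
Proof. by move=> [M pF]; exists (k * M)%N; apply: pfunX. Qed.

Lemma polyfun_sum J (r : seq J) (P : pred J) (F : J -> {ffun I -> C} -> C) :
  (forall j, polyfun (F j)) -> polyfun (fun x => \sum_(j <- r | P j) F j x).
Proof.
move=> pF; elim: r => [|j r IHr].
  by apply: eq_polyfun (polyfun_const 0) => x; rewrite big_nil.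
case Pj: (P j); last by apply: eq_polyfun IHr => x; rewrite big_cons Pj.
by apply: eq_polyfun (polyfunD (pF j) IHr) => x; rewrite big_cons Pj.
Qed.

Lemma polyfun_prod J (r : seq J) (P : pred J) (F : J -> {ffun I -> C} -> C) :
  (forall j, polyfun (F j)) -> polyfun (fun x => \prod_(j <- r | P j) F j x).
Proof.
move=> pF; elim: r => [|j r IHr].
  by apply: eq_polyfun (polyfun_const 1) => x; rewrite big_nil.
case Pj: (P j); last by apply: eq_polyfun IHr => x; rewrite big_cons Pj.
by apply: eq_polyfun (polyfunM (pF j) IHr) => x; rewrite big_cons Pj.
Qed.

Lemma polyfun_det n (A : {ffun I -> C} -> 'M[C]_n) :
  (forall i j, polyfun (fun x => A x i j)) -> polyfun (fun x => \det (A x)).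
Proof.
move=> pA; apply: polyfun_sum => s; apply: polyfunM; first exact: polyfun_const.
by apply: polyfun_prod.
Qed.

Lemma polyfun_adj n (A : {ffun I -> C} -> 'M[C]_n) :
  (forall i j, polyfun (fun x => A x i j)) ->
  forall i j, polyfun (fun x => (\adj (A x)) i j).
Proof.
case: n A => [|n] A pA i j; first by case: i.
apply: (@eq_polyfun (fun x => cofactor (A x) j i)) => [x|]; first by rewrite mxE.
apply: polyfunM; first exact: polyfun_const.
apply: polyfun_det => k l; apply: eq_polyfun (pA (lift j k) (lift i l)) => x.
by rewrite !mxE.
Qed.

(* The coordinates are changed one at a time: at each step, all but finitely
   many values keep both functions nonzero. *)
Lemma polyfun_domain F G a b : polyfun F -> polyfun G -> F a != 0 -> G b != 0 ->
  exists x, F x != 0 /\ G x != 0.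
Proof.
move=> [M pF] [M' pG].
suff loop (s : seq I) (a' b' : {ffun I -> C}) : (forall i, a' i != b' i -> i \in s) ->
    F a' != 0 -> G b' != 0 ->
    exists x, F x != 0 /\ G x != 0.
  by apply: (loop (enum I)) => i _; rewrite mem_enum.
elim: s a' b' => [|i s IHs] {}a {}b eq_ab Fa Gb.
  suff eab : a = b by exists a; rewrite {2}eab.
  by apply/ffunP => i; apply/eqP; apply: contraT => /eq_ab.
have [p _ pE] := pF a i; have [q _ qE] := pG b i.
have [t [pt qt]] : exists t, p.[t] != 0 /\ q.[t] != 0.
  have pq0 : p * q != 0.
    rewrite mulf_neq0 //; [move: Fa; rewrite -(upd_id a i) pE|move: Gb; rewrite -(upd_id b i) qE];
    by apply: contraNneq => ->; rewrite horner0.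
  apply: NNPP => no_t; case/eqP: pq0.
  apply: (poly_eq0_nat (leqnn _)) => k _; apply/eqP/negPn/negP => pqk.
  by apply: no_t; exists k%:R; move: pqk; rewrite hornerM mulf_eq0 negb_or => /andP.
apply: (IHs (upd a i t) (upd b i t)); rewrite ?pE ?qE // => j.
rewrite !ffunE; case: (eqVneq j i) => [->|ne]; first by rewrite eqxx.
by move/eq_ab; rewrite inE (negbTE ne).
Qed.

(** The coordinates leave the grid one at a time: along a single coordinate the function is a
    polynomial of degree at most [M] with the [M + 1] roots [0, ..., M]. *)
Lemma pfun_grid M F : pfun M F ->
  (forall x : {ffun I -> C}, (forall i, exists2 k, (k <= M)%N & x i = k%:R) -> F x = 0) ->
  forall x, F x = 0.
Proof.
move=> pF F0 x.
suff loop (s : seq I) (y : {ffun I -> C}) :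
    (forall i, i \notin s -> exists2 k, (k <= M)%N & y i = k%:R) -> F y = 0.
  by apply: (loop (enum I)) => i; rewrite mem_enum.
elim: s y => [|i s IHs] {}x xs; first by apply: F0 => i; apply: xs.
have [p sp pE] := pF x i; rewrite -(upd_id x i) pE.
suff -> : p = 0 by rewrite horner0.
apply: (poly_eq0_nat sp) => k; rewrite ltnS => le_k; rewrite -pE; apply: IHs => j js.
rewrite ffunE; case: (eqVneq j i) => [_|ne]; first by exists k.
by apply: xs; rewrite inE negb_or ne.
Qed.

(** * Regular functions on a principal open set *)

(** Functions [P / d^k] with the denominator cleared. Nothing is asked where [d] vanishes, so the
    conventional value of [invmx] on singular matrices does no harm. *)
Definition reg (d f : {ffun I -> C} -> C) := exists k P,
  polyfun P /\ forall x, d x != 0 -> d x ^+ k * f x = P x.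

Variable d : {ffun I -> C} -> C.
Hypothesis pd : polyfun d.

Lemma eq_reg f g : (forall x, d x != 0 -> f x = g x) -> reg d f -> reg d g.
Proof.
by move=> efg [k [P [pP fP]]]; exists k, P; split=> // x dx; rewrite -efg ?fP.
Qed.

Lemma polyfun_reg f : polyfun f -> reg d f.
Proof. by move=> pf; exists 0%N, f; split=> // x _; rewrite mul1r. Qed.

Lemma regD f g : reg d f -> reg d g -> reg d (fun x => f x + g x).
Proof.
move=> [k [P [pP fP]]] [l [Q [pQ gQ]]].
exists (k + l)%N, (fun x => d x ^+ l * P x + d x ^+ k * Q x); split.
  by apply: polyfunD; apply: polyfunM => //; apply: polyfunX.
by move=> x dx; rewrite -fP // -gQ // exprD; ring.
Qed.

Lemma regM f g : reg d f -> reg d g -> reg d (fun x => f x * g x).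
Proof.
move=> [k [P [pP fP]]] [l [Q [pQ gQ]]].
exists (k + l)%N, (fun x => P x * Q x); split; first exact: polyfunM.
by move=> x dx; rewrite -fP // -gQ // exprD; ring.
Qed.

Lemma reg_sum J (r : seq J) (f : J -> {ffun I -> C} -> C) :
  (forall j, reg d (f j)) -> reg d (fun x => \sum_(j <- r) f j x).
Proof.
move=> rf; elim: r => [|j r IHr].
  by apply: eq_reg (polyfun_reg (polyfun_const 0)) => x _; rewrite big_nil.
by apply: eq_reg (regD (rf j) IHr) => x _; rewrite big_cons.
Qed.

Lemma reg_prod J (r : seq J) (f : J -> {ffun I -> C} -> C) :
  (forall j, reg d (f j)) -> reg d (fun x => \prod_(j <- r) f j x).
Proof.
move=> rf; elim: r => [|j r IHr].
  by apply: eq_reg (polyfun_reg (polyfun_const 1)) => x _; rewrite big_nil.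
by apply: eq_reg (regM (rf j) IHr) => x _; rewrite big_cons.
Qed.

Lemma regX k f : reg d f -> reg d (fun x => f x ^+ k).
Proof.
move=> rf; elim: k => [|k IHk].
  by apply: eq_reg (polyfun_reg (polyfun_const 1)) => x _; rewrite expr0.
by apply: eq_reg (regM rf IHk) => x _; rewrite exprS.
Qed.

Lemma reg_meval m (phi : {ffun I -> C} -> 'I_m -> C) (p : {mpoly C[m]}) :
  (forall i, reg d (fun x => phi x i)) -> reg d (fun x => p.@[phi x]).
Proof.
move=> rphi; apply: (@eq_reg (fun x =>
   \sum_(u <- msupp p) p@_u * \prod_i phi x i ^+ u i)).
  by move=> x _; rewrite mevalE.
apply: reg_sum => u; apply: regM; first exact/polyfun_reg/polyfun_const.
by apply: reg_prod => i; apply: regX.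
Qed.

End PolyFun.

Arguments pfun_const {I} M c.
Arguments polyfun_const {I} c.

(** * Zariski closures of orbits *)

Section Bilinear.
Variable n : nat.
Implicit Types (S Z : pstruct n -> Prop) (s t u : pstruct n) (g h : 'M[C]_n) (x y z : 'cV[C]_n).

Lemma col_sum_ebas x : x = \sum_i x i 0 *: ebas i.
Proof.
apply/colP => k; rewrite summxE (bigD1 k) //= !mxE !eqxx mulr1 big1 ?addr0 // => i ne.
by rewrite !mxE eq_sym (negbTE ne) mulr0.
Qed.

Lemma bilDl s b x y z : bil s b (x + y) z = bil s b x z + bil s b y z.
Proof.
apply/colP => k; rewrite !mxE -big_split; apply: eq_bigr => i _ /=.
by rewrite -big_split; apply: eq_bigr => j _ /=; rewrite !mxE; ring.
Qed.

Lemma bilDr s b x y z : bil s b x (y + z) = bil s b x y + bil s b x z.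
Proof.
apply/colP => k; rewrite !mxE -big_split; apply: eq_bigr => i _ /=.
by rewrite -big_split; apply: eq_bigr => j _ /=; rewrite !mxE; ring.
Qed.

Lemma bilZl s b c x y : bil s b (c *: x) y = c *: bil s b x y.
Proof.
apply/colP => k; rewrite !mxE mulr_sumr; apply: eq_bigr => i _.
by rewrite mulr_sumr; apply: eq_bigr => j _; rewrite !mxE; ring.
Qed.

Lemma bilZr s b c x y : bil s b x (c *: y) = c *: bil s b x y.
Proof.
apply/colP => k; rewrite !mxE mulr_sumr; apply: eq_bigr => i _.
by rewrite mulr_sumr; apply: eq_bigr => j _; rewrite !mxE; ring.
Qed.

Lemma bil0l s b y : bil s b 0 y = 0.
Proof. by have := bilZl s b 0 0 y; rewrite !scale0r. Qed.

Lemma bil0r s b x : bil s b x 0 = 0.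
Proof. by have := bilZr s b 0 x 0; rewrite !scale0r. Qed.

Lemma bilNr s b x y : bil s b x (- y) = - bil s b x y.
Proof. by rewrite -scaleN1r bilZr scaleN1r. Qed.

Lemma bil_suml s b J (r : seq J) (P : pred J) (F : J -> 'cV[C]_n) y :
  bil s b (\sum_(j <- r | P j) F j) y = \sum_(j <- r | P j) bil s b (F j) y.
Proof. exact: (big_morph (fun x => bil s b x y) (fun x z => bilDl s b x z y) (bil0l s b y)). Qed.

Lemma bil_sumr s b J (r : seq J) (P : pred J) (F : J -> 'cV[C]_n) x :
  bil s b x (\sum_(j <- r | P j) F j) = \sum_(j <- r | P j) bil s b x (F j).
Proof. exact: (big_morph (bil s b x) (bilDr s b x) (bil0r s b x)). Qed.

Lemma bil_ebas s b i j k : bil s b (ebas i) (ebas j) k 0 = s (b, i, j, k).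
Proof.
rewrite mxE (bigD1 i) //= (bigD1 j) //= !mxE !eqxx !mul1r.
rewrite !big1 ?addr0 // => l ne; last by rewrite !mxE (negbTE ne) mulr0 mul0r.
by apply: big1 => m _; rewrite !mxE (negbTE ne) !mul0r.
Qed.

Lemma bil_morph_ebas s u g b :
  (forall i j, g *m bil s b (ebas i) (ebas j) = bil u b (g *m ebas i) (g *m ebas j)) ->
  forall x y, g *m bil s b x y = bil u b (g *m x) (g *m y).
Proof.
move=> gE x y; rewrite [x]col_sum_ebas [y]col_sum_ebas !mulmx_sumr !bil_suml mulmx_sumr.
apply: eq_bigr => i _; rewrite !bil_sumr mulmx_sumr; apply: eq_bigr => j _.
by rewrite -!scalemxAr !bilZl !bilZr -!scalemxAr gE.
Qed.

Lemma bil_act s g b x y : g \in unitmx ->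
  bil (act g s) b x y = g *m bil s b (invmx g *m x) (invmx g *m y).
Proof.
move=> ug; rewrite {1}[x]col_sum_ebas {1}[y]col_sum_ebas bil_suml.
rewrite {2}[x]col_sum_ebas {2}[y]col_sum_ebas !mulmx_sumr bil_suml mulmx_sumr.
apply: eq_bigr => i _; rewrite !bil_sumr mulmx_sumr; apply: eq_bigr => j _.
rewrite -!scalemxAr !bilZl !bilZr -!scalemxAr; congr (_ *: (_ *: _)).
by apply/colP => k; rewrite bil_ebas.
Qed.

Lemma bil_act_morph s g b x y : g \in unitmx ->
  bil (act g s) b (g *m x) (g *m y) = g *m bil s b x y.
Proof. by move=> ug; rewrite bil_act // !mulKmx. Qed.

Lemma pstruct_ext s t :
  (forall b i j, bil s b (ebas i) (ebas j) = bil t b (ebas i) (ebas j)) -> s = t.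
Proof.
by move=> est; apply: functional_extensionality => -[[[b i] j] k]; rewrite -!bil_ebas est.
Qed.

Lemma eq_act s u g : g \in unitmx ->
  (forall b i j, g *m bil s b (ebas i) (ebas j) = bil u b (g *m ebas i) (g *m ebas j)) ->
  u = act g s.
Proof.
move=> ug gE; apply: pstruct_ext => b i j; rewrite bil_act //.
by rewrite (bil_morph_ebas (gE b)) !mulKVmx.
Qed.

Lemma act1 s : act 1%:M s = s.
Proof. by apply/esym/eq_act; rewrite ?unitmx1 // => b i j; rewrite !mul1mx. Qed.

Lemma actM s g h : g \in unitmx -> h \in unitmx -> act g (act h s) = act (g *m h) s.
Proof.
move=> ug uh; apply: eq_act => [|b i j]; first by rewrite unitmx_mul ug.
by rewrite -!mulmxA !bil_act_morph.
Qed.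

Lemma gorbit_refl s : gorbit s s.
Proof. by exists 1%:M; rewrite ?unitmx1 ?act1. Qed.

Lemma gorbit_sym s t : gorbit s t -> gorbit t s.
Proof.
case=> g ug ->; exists (invmx g); rewrite ?unitmx_inv //.
by rewrite actM ?unitmx_inv // mulVmx // act1.
Qed.

Lemma gorbit_trans t s u : gorbit s t -> gorbit t u -> gorbit s u.
Proof. by move=> [g ug ->] [h uh ->]; exists (h *m g); rewrite ?unitmx_mul ?uh // actM. Qed.

Lemma actE s g b i j k : act g s (b, i, j, k) =
  \sum_l g k l * \sum_p \sum_q invmx g p i * invmx g q j * s (b, p, q, l).
Proof.
rewrite /act mxE; apply: eq_bigr => l _; rewrite mxE; congr (_ * _).
by apply: eq_bigr => p _; apply: eq_bigr => q _; rewrite -!colE !mxE.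
Qed.

(** Regular functions on the space of structures, kept as functions so that closed conditions can be
    written with products and determinants rather than as elements of [{mpoly}]. *)
Definition polyS (F : pstruct n -> C) := exists q : Defs.polyC n, forall u, F u = q.@[coords u].

Lemma eq_polyS F G : F =1 G -> polyS F -> polyS G.
Proof. by move=> eFG [q qE]; exists q => u; rewrite -eFG. Qed.

Lemma polyS_const c : polyS (fun=> c).
Proof. by exists c%:MP => u; rewrite mevalC. Qed.

Lemma polyS_coord m : polyS (fun u => u m).
Proof. by exists 'X_(enum_rank m) => u; rewrite mevalXU /coords enum_rankK. Qed.

Lemma polySD F G : polyS F -> polyS G -> polyS (fun u => F u + G u).
Proof. by move=> [p pE] [q qE]; exists (p + q) => u; rewrite mevalD pE qE. Qed.

Lemma polySM F G : polyS F -> polyS G -> polyS (fun u => F u * G u).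
Proof. by move=> [p pE] [q qE]; exists (p * q) => u; rewrite mevalM pE qE. Qed.

Lemma polyS_sum J (r : seq J) (P : pred J) (F : J -> pstruct n -> C) :
  (forall j, polyS (F j)) -> polyS (fun u => \sum_(j <- r | P j) F j u).
Proof.
move=> pF; elim: r => [|j r IHr].
  by apply: eq_polyS (polyS_const 0) => u; rewrite big_nil.
case Pj: (P j); last by apply: eq_polyS IHr => u; rewrite big_cons Pj.
by apply: eq_polyS (polySD (pF j) IHr) => u; rewrite big_cons Pj.
Qed.

Lemma polyS_prod J (r : seq J) (P : pred J) (F : J -> pstruct n -> C) :
  (forall j, polyS (F j)) -> polyS (fun u => \prod_(j <- r | P j) F j u).
Proof.
move=> pF; elim: r => [|j r IHr].
  by apply: eq_polyS (polyS_const 1) => u; rewrite big_nil.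
case Pj: (P j); last by apply: eq_polyS IHr => u; rewrite big_cons Pj.
by apply: eq_polyS (polySM (pF j) IHr) => u; rewrite big_cons Pj.
Qed.

Lemma polyS_det k (A : pstruct n -> 'M[C]_k) :
  (forall i j, polyS (fun u => A u i j)) -> polyS (fun u => \det (A u)).
Proof.
move=> pA; apply: polyS_sum => s; apply: polySM; first exact: polyS_const.
by apply: polyS_prod.
Qed.

Definition polySV (X : pstruct n -> 'cV[C]_n) := forall i, polyS (fun u => X u i 0).

Lemma polySV_const x : polySV (fun=> x).
Proof. by move=> i; apply: polyS_const. Qed.

Lemma polySV_bil b X Y : polySV X -> polySV Y -> polySV (fun u => bil u b (X u) (Y u)).
Proof.
move=> pX pY k.
apply: (@eq_polyS (fun u => \sum_i \sum_j X u i 0 * Y u j 0 * u (b, i, j, k))) => [u|].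
  by rewrite mxE.
apply: polyS_sum => i; apply: polyS_sum => j; apply: polySM; last exact: polyS_coord.
exact: polySM.
Qed.

Lemma polySV_iter k X Y : polySV X -> polySV Y ->
  polySV (fun u => iter k (pmu u (X u)) (Y u)).
Proof. by move=> pX pY; elim: k => [|k IHk] //=; apply: polySV_bil. Qed.

(** For fixed [g] the action is linear in the structure constants. This makes orbit closures stable
    under the group. *)
Lemma polyS_act (p : Defs.polyC n) g : polyS (fun u => p.@[coords (act g u)]).
Proof.
apply: (@eq_polyS (fun u =>
   \sum_(m <- msupp p) p@_m * \prod_i coords (act g u) i ^+ m i)) => [u|].
  by rewrite mevalE.
apply: polyS_sum => m; apply: polySM; first exact: polyS_const.
apply: polyS_prod => i; elim: (m i) => [|k IHk].
  by apply: eq_polyS (polyS_const 1) => u; rewrite expr0.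
apply: (@eq_polyS (fun u => coords (act g u) i * coords (act g u) i ^+ k)) => [u|].
  by rewrite exprS.
apply: polySM IHk; rewrite /coords; case: (enum_val i) => -[[b j] l] r.
apply: (@eq_polyS (fun u => \sum_q g r q * bil u b (invmx g *m ebas j) (invmx g *m ebas l) q 0)).
  by move=> u; rewrite /act mxE.
apply: polyS_sum => q; apply: polySM; first exact: polyS_const.
by apply: polySV_bil; apply: polySV_const.
Qed.

Lemma zclosure_polyS S F t : polyS F -> (forall u, S u -> F u = 0) -> zclosure S t -> F t = 0.
Proof. by move=> [q qE] F0 /(_ q) tS; rewrite qE tS // => u /F0; rewrite qE. Qed.

(** Open conditions travel backwards: one that holds at a point of the closure holds somewhere in
    the set. So a degeneration passes them on to some member of the orbit it comes from. *)
Lemma zclosure_nonzero S F t : polyS F -> zclosure S t -> F t != 0 ->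
  exists2 u, S u & F u != 0.
Proof.
move=> pF tS /eqP Ft; apply: NNPP => no_u; apply: Ft; apply: (zclosure_polyS pF _ tS) => u Su.
by apply/eqP; apply: contraT => Fu; case: no_u; exists u.
Qed.

Lemma sub_zclosure S t : S t -> zclosure S t.
Proof. by move=> St p; apply. Qed.

Lemma zclosure_sub S Z t : (forall u, S u -> zclosure Z u) -> zclosure S t -> zclosure Z t.
Proof. by move=> sSZ tS p pZ; apply: tS => u /sSZ; apply. Qed.

Lemma zclosed_zclosure S : zclosed (zclosure S).
Proof. by exists (fun p => forall u, S u -> p.@[coords u] = 0). Qed.

Lemma zclosure_act s t g : g \in unitmx ->
  zclosure (gorbit s) t -> zclosure (gorbit s) (act g t).
Proof.
move=> ug st p p0; apply: zclosure_polyS (polyS_act p g) _ st => u su.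
by apply/p0/(gorbit_trans su); exists g.
Qed.

Lemma zclosure_gorbit_trans s t u : zclosure (gorbit s) t ->
  zclosure (gorbit t) u -> zclosure (gorbit s) u.
Proof. by move=> st; apply: zclosure_sub => _ [g ug ->]; apply: zclosure_act. Qed.

Lemma iso_degen s t : gorbit s t -> degen s t.
Proof.
by move=> st; exists t, t; split => //; [exact: gorbit_refl|exact/sub_zclosure/gorbit_refl].
Qed.

(** The choice of representatives in [degen] is immaterial because an orbit closure is a union of
    orbits. *)
Lemma degenP s t : degen s t <-> zclosure (gorbit s) t.
Proof.
split=> [[s' [t' [ss tt st]]]|st]; last by exists s, t; split => //; apply: gorbit_refl.
have st' := zclosure_gorbit_trans (sub_zclosure ss) st.
by case: (gorbit_sym tt) => g ug ->; apply: zclosure_act.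
Qed.

Lemma degen_trans s t u : degen s t -> degen t u -> degen s u.
Proof. by move=> /degenP st /degenP tu; apply/degenP/(zclosure_gorbit_trans st). Qed.

End Bilinear.

Arguments polyS_const {n} c.
Arguments polyS_coord {n} m.

(** * Irreducibility of parametrized sets and of orbit closures *)

Section OrbitClosure.
Variable n : nat.
Implicit Types (S Z : pstruct n -> Prop) (s t u : pstruct n) (g h : 'M[C]_n).

(** If neither closed set contains the image, each has an equation violated somewhere on it. With
    denominators cleared, these become nonzero polynomial functions of the parameters, and a common
    point where both are nonzero is sent outside both closed sets. *)
Lemma irreducible_param (I : finType) (d : {ffun I -> C} -> C)
    (phi : {ffun I -> C} -> pstruct n) a :
  polyfun d -> (forall m, reg d (fun x : {ffun I -> C} => phi x m)) -> d a != 0 ->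
  zirreducible (zclosure (fun t => exists2 x : {ffun I -> C}, d x != 0 & t = phi x)).
Proof.
set S := (X in zclosure X) => pd rphi da; split; first exact: zclosed_zclosure.
  by exists (phi a); apply: sub_zclosure; exists a.
have clear_den p (x : {ffun I -> C}) : d x != 0 -> p.@[coords (phi x)] != 0 -> exists P,
    [/\ polyfun P, P x != 0 &
        forall y : {ffun I -> C}, P y != 0 -> d y != 0 /\ p.@[coords (phi y)] != 0].
  have [k [P [pP Pd]]] : reg d (fun y => p.@[coords (phi y)]).
    by apply: (reg_meval pd) => i; apply: rphi.
  (* The extra factor [d] records [d y != 0], where alone [P] controls [p]. *)
  move=> dx px; exists (fun y : {ffun I -> C} => d y * P y); split=> [||y]; first exact: polyfunM.
    by rewrite -Pd // !mulf_neq0 ?expf_neq0.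
  rewrite mulf_eq0 negb_or => /andP[dy]; rewrite -Pd // mulf_eq0 negb_or => /andP[_].
  by split.
move=> Z1 Z2 [P1 Z1E] [P2 Z2E] sZ; apply: NNPP => /not_or_and[nZ1 nZ2].
have pick Z P : (forall t, Z t <-> forall p, P p -> p.@[coords t] = 0) ->
    ~ zsubset (zclosure S) Z ->
    exists p x, [/\ P p, d x != 0 & p.@[coords (phi x)] != 0].
  move=> ZE nZ; apply: NNPP => no; apply: nZ => t tS; apply/ZE => p Pp.
  apply: tS => _ [x dx ->]; apply/eqP; apply: contraT => px.
  by case: no; exists p, x.
have [p1 [x1 [Pp1 dx1 px1]]] := pick _ _ Z1E nZ1.
have [p2 [x2 [Pp2 dx2 px2]]] := pick _ _ Z2E nZ2.
have [F1 [pF1 F1x F1E]] := clear_den _ _ dx1 px1.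
have [F2 [pF2 F2x F2E]] := clear_den _ _ dx2 px2.
have [x [/F1E[dx p1x] /F2E[_ p2x]]] := polyfun_domain pF1 pF2 F1x F2x.
have [/Z1E/(_ _ Pp1)|/Z2E/(_ _ Pp2)] : Z1 (phi x) \/ Z2 (phi x).
- by apply/sZ/sub_zclosure; exists x.
- by move/eqP; rewrite (negbTE p1x).
- by move/eqP; rewrite (negbTE p2x).
Qed.

(** By Cramer's rule the determinant is the only denominator of the inverse matrix. *)
Lemma reg_act (I : finType) (A : {ffun I -> C} -> 'M[C]_n) (phi : {ffun I -> C} -> pstruct n) :
  (forall i j, polyfun (fun x : {ffun I -> C} => A x i j)) ->
  (forall m, polyfun (fun x : {ffun I -> C} => phi x m)) ->
  forall m, reg (fun x : {ffun _} => \det (A x)) (fun x : {ffun _ -> C} => act (A x) (phi x) m).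
Proof.
move=> pA pphi [[[b i] j] k]; have pd := polyfun_det pA.
have rV p q : reg (fun x : {ffun _} => \det (A x)) (fun x : {ffun I -> C} => invmx (A x) p q).
  exists 1%N, (fun x => (\adj (A x)) p q); split; first exact: polyfun_adj.
  by move=> x dx; rewrite /invmx unitmxE unitfE dx mxE expr1 mulVKf.
apply: (@eq_reg _ _ (fun x => \sum_l A x k l *
  \sum_p \sum_q invmx (A x) p i * invmx (A x) q j * phi x (b, p, q, l))).
  by move=> x _; rewrite actE.
apply: (reg_sum pd) => l; apply: regM; first exact: polyfun_reg.
apply: (reg_sum pd) => p; apply: (reg_sum pd) => q.
by apply: regM; [apply: regM|apply: polyfun_reg].
Qed.

Lemma zirreducible_ext (Z Z' : pstruct n -> Prop) :
  (forall t, Z t <-> Z' t) -> zirreducible Z -> zirreducible Z'.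
Proof.
move=> eZ [[P PE] [t Zt] irrZ]; split.
- by exists P => u; rewrite -eZ.
- by exists t; apply/eZ.
move=> Z1 Z2 c1 c2 sZ; case: (irrZ Z1 Z2 c1 c2) => [u /eZ/sZ //|s1|s2].
  by left=> u /eZ/s1.
by right=> u /eZ/s2.
Qed.

Definition mx_of (x : {ffun 'I_n * 'I_n -> C}) : 'M[C]_n := \matrix_(i, j) x (i, j).

Lemma mx_ofK g : mx_of [ffun p => g p.1 p.2] = g.
Proof. by apply/matrixP => i j; rewrite mxE ffunE. Qed.

Lemma polyfun_mx_of i j : polyfun (fun x : {ffun _} => mx_of x i j).
Proof. by apply: eq_polyfun (polyfun_coord (i, j)) => x; rewrite mxE. Qed.

Lemma gorbit_mx_of s t : gorbit s t <->
  exists2 x : {ffun 'I_n * 'I_n -> C}, \det (mx_of x) != 0 & t = act (mx_of x) s.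
Proof.
split=> [[g ug ->]|[x dx ->]]; last by exists (mx_of x); rewrite // unitmxE unitfE.
by exists [ffun p => g p.1 p.2]; rewrite mx_ofK // -unitfE -unitmxE.
Qed.

Lemma zclosure_ext (S S' : pstruct n -> Prop) t :
  (forall u, S u <-> S' u) -> zclosure S t -> zclosure S' t.
Proof. by move=> eS; apply: zclosure_sub => u /eS; apply: sub_zclosure. Qed.

Lemma irreducible_gorbit s : zirreducible (zclosure (gorbit s)).
Proof.
apply: (zirreducible_ext _ (@irreducible_param _ (fun x : {ffun _} => \det (mx_of x))
  (fun x : {ffun _ -> C} => act (mx_of x) s) [ffun p => (1%:M : 'M[C]_n) p.1 p.2] _ _ _)).
- by move=> t; split; apply: zclosure_ext => u; split=> /gorbit_mx_of.
- exact/polyfun_det/polyfun_mx_of.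
- by apply: reg_act; [apply: polyfun_mx_of|move=> m; apply: polyfun_const].
- by rewrite mx_ofK det1 oner_neq0.
Qed.

(* The orbit closure is irreducible, so [D != 0] cuts out a dense part of the orbit. *)
Lemma gorbit_generic s (D : pstruct n -> C) (T : pstruct n -> Prop) u :
  polyS D -> gorbit s u -> D u != 0 ->
  (forall t, gorbit s t -> D t != 0 -> T t) ->
  forall t, gorbit s t -> zclosure T t.
Proof.
move=> [q qE] su Du sT t st p p0; have [_ _ irr] := irreducible_gorbit s.
have zc (r : Defs.polyC n) : zclosed (fun v => r.@[coords v] = 0).
  by exists (fun r' => r' = r) => v; split=> [? _ ->|/(_ r)/(_ erefl)].
have [v sv|/(_ t (sub_zclosure st))//|/(_ u (sub_zclosure su))] := irr _ _ (zc p) (zc q).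
  suff : (p * q).@[coords v] = 0.
    by rewrite mevalM => /eqP; rewrite mulf_eq0 => /orP[]/eqP; [left|right].
  apply: sv => w sw; rewrite mevalM.
  by have [Dw|/(sT _ sw)/p0 ->] := eqVneq (D w) 0; rewrite ?mul0r // -qE Dw mulr0.
by rewrite -qE => /eqP; rewrite (negbTE Du).
Qed.

End OrbitClosure.

(** * Krull dimension *)

(* Exponent vectors with entries [< N]; the first component belongs to the last
   variable, so that [mexp N k.+1] treats relations as polynomials in that variable. *)
Fixpoint mexp (N k : nat) : finType :=
  if k is k'.+1 then ('I_N * mexp N k')%type : finType else unit.

Fixpoint mon N (f : nat -> C) k : mexp N k -> C :=
  if k is k'.+1 then fun e : mexp N k'.+1 => f k' ^+ e.1 * mon f e.2 else fun=> 1.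

Lemma card_mexp N k : #|mexp N k| = (N ^ k)%N.
Proof.
elim: k => [|k IHk] /=; first by rewrite card_unit.
by rewrite card_prod card_ord IHk expnS.
Qed.

Lemma eq_mon N f g k (e : mexp N k) : (forall i, (i < k)%N -> f i = g i) -> mon f e = mon g e.
Proof.
elim: k e => [|k IHk] //= e efg; rewrite efg // (IHk e.2) // => i lt_ik.
by apply: efg; apply: ltnW.
Qed.

Section Dimension.
Variable n : nat.
Implicit Types (S T A : pstruct n -> Prop) (Z : nat -> pstruct n -> Prop).
Implicit Types (f : nat -> pstruct n -> C).

(** Algebraic dependence on [S] of [f 0], ..., [f k.-1]. A common bound [N] on the exponents makes
    the monomials a finite type. *)
Definition dependent S f k := exists N (c : mexp N k -> C),
  (exists e, c e != 0) /\ forall s, S s -> \sum_e c e * mon (f^~ s) e = 0.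

Lemma dependent_sub S T f k : (forall s, S s -> T s) -> dependent T f k -> dependent S f k.
Proof. by move=> sST [N [c [c0 cT]]]; exists N, c; split=> // s /sST/cT. Qed.

Lemma polyS_exp (F : pstruct n -> C) k : polyS F -> polyS (fun s => F s ^+ k).
Proof.
move=> pF; elim: k => [|k IHk]; first by apply: eq_polyS (polyS_const 1) => s; rewrite expr0.
by apply: eq_polyS (polySM pF IHk) => s; rewrite exprS.
Qed.

Lemma polyS_mon N f k (e : mexp N k) : (forall i, polyS (f i)) -> polyS (fun s => mon (f^~ s) e).
Proof.
move=> pf; elim: k e => [|k IHk] e /=; first exact: polyS_const.
by apply: polySM (IHk _); apply: polyS_exp.
Qed.

Lemma dependent_zclosure S f k : (forall i, polyS (f i)) ->
  dependent S f k -> dependent (zclosure S) f k.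
Proof.
move=> pf [N [c [c0 cS]]]; exists N, c; split=> // s.
apply: (@zclosure_polyS _ S (fun s => \sum_e c e * mon (f^~ s) e)) => //.
by apply: polyS_sum => e; apply: polySM; [apply: polyS_const|apply: polyS_mon].
Qed.

Lemma zclosed_zero (F : pstruct n -> C) : polyS F -> zclosed (fun s => F s = 0).
Proof. by move=> [q qE]; exists (fun p => p = q) => s; rewrite qE; split=> [? _ ->|->]. Qed.

(* Lift algebraically independent functions on [Z k] to [Z k.+1] and add a
   function [g] vanishing on [Z k] but not on [Z k.+1]: dividing a relation by
   the largest possible power of [g] and restricting it to [Z k] gives a
   nontrivial relation there. *)
Lemma chain_independent A Z k : irr_chain A Z k ->
  exists f, (forall i, polyS (f i)) /\ ~ dependent (Z k) f k.
Proof.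
elim: k => [|k IHk] [irrZ sZ].
  exists (fun _ _ => 0); split=> [i|[N [c [[[] /eqP c0] cZ]]]]; first exact: polyS_const.
  have [[_ [t Zt] _] _] := irrZ 0%N isT; case: c0; rewrite -[RHS](cZ t Zt).
  by rewrite (bigD1 tt) //= mulr1 big1 ?addr0 // => -[].
have [f [pf indf]] : exists f, (forall i, polyS (f i)) /\ ~ dependent (Z k) f k.
  apply: IHk; split=> i lt_ik; last exact/sZ/ltnW.
  exact/irrZ/leqW.
have [sZk nsZk] := sZ k (ltnSn k).
have [[[Pk PkE] _ _] _] := irrZ k (leqnSn k).
have [[_ _ irr] _] := irrZ k.+1 (leqnn _).
have [g [pg gZk [t0 Zt0 gt0]]] : exists g : pstruct n -> C, [/\ polyS g,
    forall s, Z k s -> g s = 0 & exists2 t, Z k.+1 t & g t != 0].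
  apply: NNPP => no_g; apply: nsZk => t Zt; apply/PkE => p Pp.
  apply: NNPP => /eqP pt; apply: no_g; exists (fun s => p.@[coords s]).
  split=> [|s /PkE/(_ p Pp)|] //.
    by exists p.
  by exists t.
pose f' i := if i == k then g else f i.
exists f'; split=> [i|[N [c [[e0 c0] cZ]]]]; first by rewrite /f'; case: ifP.
have f'k s (e : mexp N k) : mon (f'^~ s) e = mon (f^~ s) e.
  by apply: eq_mon => i lt_ik; rewrite /f' (ltn_eqF lt_ik).
have ex_r : exists r, [exists e : 'I_N * mexp N k, (c e != 0) && (e.1 == r :> nat)].
  by exists e0.1; apply/existsP; exists e0; rewrite c0 eqxx.
(* [r] is the largest power of [g] that divides the relation formally; [H] below is the quotient. *)
case: (ex_minnP ex_r) => r /existsP[[r' e'] /= /andP[ce' /eqP r'E]] min_r.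
have cmin (e : 'I_N * mexp N k) : (e.1 < r)%N -> c e = 0.
  move=> lt_er; apply/eqP; apply: contraTT lt_er => ce; rewrite -leqNgt.
  by apply: min_r; apply/existsP; exists e; rewrite ce eqxx.
pose H s := \sum_(e : 'I_N * mexp N k) c e * (g s ^+ (e.1 - r) * mon (f^~ s) e.2).
have pH : polyS H.
  apply: polyS_sum => e; apply: polySM; first exact: polyS_const.
  by apply: polySM; [apply: polyS_exp|apply: polyS_mon].
have gH s : Z k.+1 s -> g s ^+ r * H s = 0.
  move=> Zs; rewrite -[RHS](cZ s Zs) mulr_sumr; apply: eq_bigr => e _ /=.
  have [lt_er|le_re] := ltnP e.1 r; first by rewrite cmin // !(mul0r, mulr0).
  by rewrite {1}/f' eqxx f'k -{2}(subnKC le_re) exprD; ring.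
(* [g ^ r * H] vanishes on the irreducible set [Z k.+1] and [g] does not, hence [H] does. *)
have [s Zs|sg|sH] := irr _ _ (zclosed_zero pg) (zclosed_zero pH).
- move/eqP: (gH s Zs); rewrite mulf_eq0 expf_eq0 => /orP[/andP[_]|]/eqP; by [left|right].
- by move/eqP: (sg t0 Zt0); rewrite (negbTE gt0).
apply: indf; exists N, (fun e => c (r', e)); split=> [|s Zs]; first by exists e'.
rewrite -[RHS](sH s (sZk s Zs)) /H.
rewrite (eq_bigr (fun e => c (e.1, e.2) * (g s ^+ (e.1 - r) * mon (f^~ s) e.2))); last by case.
rewrite -(pair_bigA _ (fun a e => c (a, e) * (g s ^+ (a - r) * mon (f^~ s) e))) /=.
rewrite (bigD1 r') //= [X in _ + X]big1 ?addr0 => [|a ne_a].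
  by apply: eq_bigr => e _; rewrite r'E subnn expr0 mul1r.
apply: big1 => e _; have [lt_ar|le_ra] := ltnP a r; first by rewrite cmin ?mul0r.
rewrite gZk // expr0n subn_eq0 [(a <= r)%N]negbTE ?mul0r ?mulr0 // -ltnNge.
by rewrite ltn_neqAle le_ra andbT -r'E eq_sym.
Qed.

Lemma kernel_vector (R : finType) (K : finType) (a : R -> K -> C) : (#|K| < #|R|)%N ->
  exists2 c : R -> C, exists e, c e != 0 & forall b, \sum_e c e * a e b = 0.
Proof.
move=> lt_KR; pose A := \matrix_(i < #|R|, j < #|K|) a (enum_val i) (enum_val j).
have : kermx A != 0.
  rewrite kermx_eq0 /row_free neq_ltn; apply/orP; left.
  exact: leq_ltn_trans (rank_leq_col A) lt_KR.
case/rowV0Pn => v /sub_kermxP vA0 v0; exists (fun e => v 0 (enum_rank e)).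
  have [i vi] : exists i, v 0 i != 0.
    apply: NNPP => no_i; case/eqP: v0; apply/rowP => i; rewrite mxE.
    by apply/eqP; apply: contraT => vi; case: no_i; exists i.
  by exists (enum_val i); rewrite enum_valK.
move=> b; rewrite (reindex _ (onW_bij _ (@enum_val_bij R))) /=.
have := congr1 (fun M : 'rV_ _ => M 0 (enum_rank b)) vA0; rewrite !mxE => {2}<-.
by apply: eq_bigr => i _; rewrite enum_valK !mxE enum_rankK.
Qed.

(* There are [N ^ k] monomials, but only [O(N ^ #|I|)] grid points are needed
   to test whether a combination of them vanishes. *)
Lemma param_dependent (I : finType) (d : {ffun I -> C} -> C)
    (phi : {ffun I -> C} -> pstruct n) f k :
  polyfun d -> (forall m, reg d (fun x : {ffun I -> C} => phi x m)) ->
  (forall i, polyS (f i)) -> (#|I| < k)%N ->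
  dependent (fun t => exists2 x : {ffun I -> C}, d x != 0 & t = phi x) f k.
Proof.
move=> pd rphi pf lt_Ik.
(* One exponent [l] of the denominator and one degree bound [M] are made to serve all [k]
   functions. *)
have [l [M [P [pdl pP]]]] : exists l M (P : nat -> {ffun I -> C} -> C),
    pfun M (fun x : {ffun I -> C} => d x ^+ l) /\ forall i, (i < k)%N -> pfun M (P i) /\
      forall x : {ffun I -> C}, d x != 0 -> d x ^+ l * f i (phi x) = P i x.
  elim: k {lt_Ik} => [|k [l [M [P [pdl pP]]]]].
    exists 0%N, 0%N, (fun _ _ => 0); split=> //.
    by apply: eq_pfun (pfun_const _ 1) => x; rewrite expr0.
  have [q qE] := pf k.
  have [l' [Q [[M1 pQ] QE]]] : reg d (fun x : {ffun I -> C} => f k (phi x)).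
    apply: (@eq_reg _ _ (fun x : {ffun I -> C} => q.@[coords (phi x)])) => [x _|].
      by rewrite qE.
    by apply: (reg_meval pd) => i; apply: rphi.
  have [M2 pdl'] : polyfun (fun x : {ffun I -> C} => d x ^+ l') by apply: polyfunX.
  exists (l + l')%N, (M + M1 + M2)%N,
    (fun i x => if i == k then d x ^+ l * Q x else d x ^+ l' * P i x).
  split=> [|i].
    apply: eq_pfun (pfun_le _ (pfunM pdl pdl')); last by lia.
    by move=> x; rewrite exprD.
  rewrite ltnS leq_eqVlt; case: eqVneq => [-> _|_ /= /pP[pPi PiE]]; split=> [|x dx].
  - by apply: pfun_le (pfunM pdl pQ); lia.
  - by rewrite -QE // exprD; ring.
  - by apply: pfun_le (pfunM pdl' pPi); lia.
  - by rewrite -PiE // exprD; ring.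
(* As [(k * M).+1 ^ #|I| < N], the grid has at most [((k * M).+1 * N) ^ #|I| < N ^ #|I|.+1 <= N ^ k]
   points, fewer than there are monomials. *)
pose N := ((k * M).+1 ^ #|I|).+1.
(* Each factor [f i ^ a] is multiplied by [d ^ (l * N)], whatever [a] is: all monomials then carry
   the same power of [d] and are polynomial in the parameters. *)
pose hmon := fix hmon j : mexp N j -> {ffun I -> C} -> C :=
  if j is j'.+1 then fun (e : mexp N j'.+1) x =>
    (P j' x ^+ e.1 * (d x ^+ l) ^+ (N - e.1)) * hmon j' e.2 x else fun _ _ => 1.
have phmon j (e : mexp N j) : (j <= k)%N -> pfun (j * (N * M)) (hmon j e).
  elim: j e => [|j IHj] e le_jk /=; first exact: pfun_const.
  rewrite mulSn; apply: pfunM (IHj _ (ltnW le_jk)).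
  have -> : (N * M = e.1 * M + (N - e.1) * M)%N by rewrite -mulnDl subnKC // ltnW.
  by apply: pfunM; apply: pfunX => //; case: (pP j le_jk).
have hmonE j (e : mexp N j) (x : {ffun I -> C}) : (j <= k)%N -> d x != 0 ->
    hmon j e x = (d x ^+ l) ^+ (j * N) * mon (f^~ (phi x)) e.
  move=> + dx; elim: j e => [|j IHj] e le_jk /=; first by rewrite mul0n expr0 mulr1.
  rewrite IHj ?(ltnW le_jk) //; have [_ <- //] := pP j le_jk.
  have -> : (d x ^+ l) ^+ (j.+1 * N) =
      (d x ^+ l) ^+ e.1 * (d x ^+ l) ^+ (N - e.1) * (d x ^+ l) ^+ (j * N).
    by rewrite -!exprD subnKC ?mulSn // ltnW.
  by rewrite exprMn; ring.
pose grid (b : {ffun I -> 'I_(k * (N * M)).+1}) : {ffun I -> C} := [ffun i => (b i)%:R].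
have [c c0 cgrid] : exists2 c : mexp N k -> C, exists e, c e != 0 &
    forall b, \sum_e c e * hmon k e (grid b) = 0.
  apply: kernel_vector; rewrite card_mexp card_ffun card_ord.
  have le1 : ((k * (N * M)).+1 <= (k * M).+1 * N)%N by rewrite /N; nia.
  have le2 : ((k * (N * M)).+1 ^ #|I| <= ((k * M).+1 * N) ^ #|I|)%N.
    by case: (#|I|) => // i; rewrite leq_exp2r.
  apply: leq_ltn_trans le2 _; rewrite expnMn.
  by apply: (@leq_trans (N ^ #|I|.+1)); [rewrite expnS ltn_pmul2r ?expn_gt0|rewrite leq_pexp2l].
exists N, c; split=> // _ [x dx ->].
have : \sum_e c e * hmon k e x = 0.
  apply: (@pfun_grid I (k * (N * M)) (fun y => \sum_e c e * hmon k e y)) => [|y yE].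
    by apply: pfun_sum => e; exact: pfunM (pfun_const 0 (c e)) (phmon k e (leqnn k)).
  have /fin_all_exists[b bE] i : exists j : 'I_(k * (N * M)).+1, y i = j%:R.
    by have [j lt_j ->] := yE i; exists (Ordinal (lt_j : (j < (k * (N * M)).+1)%N)).
  suff -> : y = grid (finfun b) by [].
  by apply/ffunP => i; rewrite !ffunE.
rewrite (eq_bigr (fun e => (d x ^+ l) ^+ (k * N) * (c e * mon (f^~ (phi x)) e))).
  by rewrite -mulr_sumr => /eqP; rewrite mulf_eq0 !expf_eq0 (negbTE dx) !andbF => /eqP.
by move=> e _; rewrite hmonE // mulrCA.
Qed.

(** The [k] independent functions on the top of such a chain would be dependent on the parametrized
    set, hence on its closure, which contains that top. *)
Lemma no_long_chain (I : finType) (d : {ffun I -> C} -> C)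
    (phi : {ffun I -> C} -> pstruct n) S k :
  polyfun d -> (forall m, reg d (fun x : {ffun I -> C} => phi x m)) ->
  (forall s, S s -> zclosure (fun t => exists2 x : {ffun I -> C}, d x != 0 & t = phi x) s) ->
  (#|I| < k)%N -> ~ exists Z, irr_chain (zclosure S) Z k.
Proof.
move=> pd rphi sS lt_Ik [Z chZ]; have [f [pf]] := chain_independent chZ; apply.
have [_ sZS] := chZ.1 k (leqnn k).
apply: dependent_sub (dependent_zclosure pf (param_dependent pd rphi pf lt_Ik)) => s Zs.
exact: zclosure_sub (sZS s Zs).
Qed.

Lemma irr_chain_extend A B Z k : zirreducible B -> (forall s, A s -> B s) ->
  (exists2 t, B t & ~ A t) -> irr_chain A Z k -> exists Z', irr_chain B Z' k.+1.
Proof.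
move=> irrB sAB [t Bt At] [irrZ sZ]; exists (fun i => if (i <= k)%N then Z i else B).
split=> i.
  case: (leqP i k) => [le_ik _|_ _]; last by split=> // s.
  by have [? sZA] := irrZ i le_ik; split=> // s /sZA/sAB.
move=> lt_ik1; have [->|lt_ik] : i = k \/ (i < k)%N by lia.
  have [_ sZA] := irrZ k (leqnn k).
  by rewrite leqnn ltnn; split=> [s /sZA/sAB|/(_ t Bt)/sZA].
by rewrite ltnW // lt_ik; apply: sZ.
Qed.

End Dimension.

(** * The algebras in coordinates *)

(* 1-based basis vectors; [vec k = 0] unless [0 < k <= n]. *)
Definition vec {n} (k : nat) : 'cV[C]_n := \col_i (i.+1 == k)%:R.

Lemma ebas_vec n (i : 'I_n) : ebas i = vec i.+1.
Proof. by apply/colP => k; rewrite !mxE eqSS andbT. Qed.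

Lemma vec_gt n k : (n < k)%N -> vec k = 0 :> 'cV_n.
Proof. by move=> lt_nk; apply/colP => i; rewrite !mxE ltn_eqF // (leq_trans _ lt_nk) // ltnS. Qed.

Lemma vecP n k : (0 < k <= n)%N -> exists2 i : 'I_n, k = i.+1 & vec k = ebas i.
Proof.
case: k => // k lt_kn.
by exists (Ordinal (lt_kn : (k < n)%N)); rewrite ?ebas_vec.
Qed.

(* [filprod] is elaborated in [ring_scope], with the ring addition of [nat]. *)
Lemma filprodE K i j k : filprod K i j k = ((i + j == k) && (i + j <= K))%N%:R.
Proof. by []. Qed.

Definition filalg n (K : nat) : pstruct n := alg_of n (filprod K) (fun _ _ _ => 0).

(* [qalg m] lives in dimension [n = m + 2], so that [e_(m+1) = e_(n-1)]. *)
Definition qalg m (al ga de : C) : pstruct m.+2 := alg_of m.+2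
  (fun i j k => filprod m.+1 i j k + al * (kd i m.+2 * kd j m.+2 * kd k m.+1))
  (fun i j k => (kd i 1 * kd j m.+2 - kd i m.+2 * kd j 1) * (ga * kd k m.+1 + de * kd k m.+2)).

Arguments filalg n K : clear implicits.
Arguments qalg m al ga de : clear implicits.

Lemma scale_bool n (b : bool) (x : 'cV[C]_n) : b%:R *: x = if b then x else 0.
Proof. by case: b; [apply: scale1r|apply: scale0r]. Qed.

Section ProductLinear.
Variables (n : nat) (s : pstruct n).
Implicit Types (x y z : 'cV[C]_n).

Lemma pmuDl x y z : pmu s (x + y) z = pmu s x z + pmu s y z. Proof. exact: bilDl. Qed.
Lemma pmuDr x y z : pmu s x (y + z) = pmu s x y + pmu s x z. Proof. exact: bilDr. Qed.
Lemma pmuZl c x y : pmu s (c *: x) y = c *: pmu s x y. Proof. exact: bilZl. Qed.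
Lemma pmuZr c x y : pmu s x (c *: y) = c *: pmu s x y. Proof. exact: bilZr. Qed.
End ProductLinear.

Section Filiform.
Variables (n K : nat).
Implicit Types (x y z : 'cV[C]_n).
Local Notation fil := (pmu (filalg n K)).

Lemma fil_vec a b : (K <= n)%N -> (0 < a)%N -> (0 < b)%N ->
  fil (vec a) (vec b) = (a + b <= K)%N%:R *: vec (a + b)%N.
Proof.
move=> le_Kn a0 b0.
have [le_an|gt_an] := leqP a n; last first.
  by rewrite vec_gt // /pmu bil0l (_ : _ <= _ = false)%N ?scale0r //; lia.
have [le_bn|gt_bn] := leqP b n; last first.
  by rewrite (vec_gt gt_bn) /pmu bil0r (_ : _ <= _ = false)%N ?scale0r //; lia.
have [i -> ->] : exists2 i : 'I_n, a = i.+1 & vec a = ebas i by apply: vecP; rewrite a0.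
have [j -> ->] : exists2 j : 'I_n, b = j.+1 & vec b = ebas j by apply: vecP; rewrite b0.
apply/colP => k; rewrite /pmu bil_ebas !mxE /= filprodE eq_sym -natrM mulnb andbC.
by rewrite [k.+1 == _]eq_sym.
Qed.

Lemma filC x y : fil x y = fil y x.
Proof.
apply/colP => k; rewrite !mxE exchange_big; apply: eq_bigr => i _; apply: eq_bigr => j _.
rewrite [y _ _ * _]mulrC; congr (_ * _).
by rewrite /filalg /alg_of !filprodE [(j.+1 + _)%N]addnC.
Qed.

Lemma filA x y z : (K <= n)%N -> fil (fil x y) z = fil x (fil y z).
Proof.
move=> le_Kn; rewrite /pmu [x]col_sum_ebas !bil_suml; apply: eq_bigr => i _.
rewrite !bilZl; congr (_ *: _); rewrite [y]col_sum_ebas bil_sumr !bil_suml bil_sumr.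
apply: eq_bigr => j _; rewrite !(bilZl, bilZr); congr (_ *: _).
rewrite [z]col_sum_ebas !bil_sumr; apply: eq_bigr => k _; rewrite !bilZr; congr (_ *: _).
rewrite !ebas_vec -!/(pmu _ _ _) !fil_vec // /pmu !(bilZl, bilZr) -!/(pmu _ _ _).
rewrite !fil_vec ?addn_gt0 // !scalerA -!natrM !mulnb addnA; congr (_%:R *: _).
by congr nat_of_bool; lia.
Qed.

(** The product adds degrees and every degree is at least 1, so each multiplication moves one step
    down the degree filtration. *)
Lemma fil_low x y d : (forall j : 'I_n, (j < d)%N -> y j 0 = 0) ->
  forall k : 'I_n, (k < d.+1)%N -> fil x y k 0 = 0.
Proof.
move=> y0 k lt_kd; rewrite mxE big1 // => i _; rewrite big1 // => j _ /=.
rewrite filprodE; case: eqP => /= [eq_ijk|_]; last by rewrite mulr0.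
by rewrite y0 ?mulr0 ?mul0r //; lia.
Qed.

Lemma fil_top x y (k : 'I_n) : (K <= k)%N -> fil x y k 0 = 0.
Proof.
move=> le_Kk; rewrite mxE big1 // => i _; rewrite big1 // => j _ /=.
rewrite filprodE; case: eqP => /= [eq_ijk|_]; last by rewrite mulr0.
by rewrite (_ : _ <= _ = false)%N ?mulr0 //; lia.
Qed.

Lemma fil_pbr x y : pbr (filalg n K) x y = 0.
Proof. by apply/colP => k; rewrite !mxE big1 // => i _; rewrite big1 // => j _; rewrite mulr0. Qed.

Lemma fil_poisson : (K <= n)%N -> is_poisson (filalg n K).
Proof.
move=> le_Kn; split=> [|x y z||x y z|x y z]; rewrite ?fil_pbr.
- exact: filC.
- exact: filA.
- by move=> x; rewrite fil_pbr.
- by rewrite !addr0.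
- by rewrite /pmu bil0l bil0r addr0.
Qed.

Lemma fil_iter x y d (k : 'I_n) : (k < d)%N -> iter d (fil x) y k 0 = 0.
Proof. by elim: d k => [|d IHd] //= k; apply: fil_low. Qed.

End Filiform.

Section Qalg.
Variables (m : nat) (al ga de : C).
Local Notation q := (qalg m al ga de).
Local Notation fil := (pmu (filalg m.+2 m.+1)).
Implicit Types (x y z : 'cV[C]_m.+2).

Lemma sum_kd p (F : 'I_p -> C) (a : 'I_p) : \sum_i F i * kd i.+1 a.+1 = F a.
Proof.
rewrite (bigD1 a) //= /kd eqxx mulr1 big1 ?addr0 // => i ne.
by rewrite eqSS (inj_eq val_inj) (negbTE ne) mulr0.
Qed.

Lemma pmu_qalg x y : pmu q x y =
  fil x y + (al * (x ord_max 0 * y ord_max 0)) *: vec m.+1.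
Proof.
apply/colP => k; rewrite !mxE -[X in X * y _ _](sum_kd (fun i => x i 0)).
rewrite -(sum_kd (fun i => y i 0)) mulr_suml mulr_sumr mulr_suml -big_split.
apply: eq_bigr => i _ /=; rewrite mulr_sumr mulr_sumr mulr_suml -big_split.
by apply: eq_bigr => j _ /=; rewrite /kd; ring.
Qed.

Lemma pbr_qalg x y : pbr q x y =
  (x 0 0 * y ord_max 0 - x ord_max 0 * y 0 0) *: (ga *: vec m.+1 + de *: vec m.+2).
Proof.
apply/colP => k; rewrite !mxE -(sum_kd (fun i => x i 0)) -(sum_kd (fun i => x i 0)).
rewrite -(sum_kd (fun i => y i 0)) -(sum_kd (fun i => y i 0)).
rewrite !mulr_suml -sumrB mulr_suml; apply: eq_bigr => i _.
rewrite !mulr_sumr -sumrB mulr_suml; apply: eq_bigr => j _ /=.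
by rewrite /kd; ring.
Qed.

Lemma qalg_top x y : pmu q x y ord_max 0 = 0.
Proof. by rewrite pmu_qalg mxE fil_top // !mxE /= eqSS (gtn_eqF (ltnSn m)) mulr0 addr0. Qed.

Lemma qalg_low x y : (0 < m)%N -> pmu q x y 0 0 = 0.
Proof.
move=> m0; rewrite pmu_qalg mxE (@fil_low _ _ _ _ 0) // !mxE /= eqSS.
by rewrite (ltn_eqF m0) mulr0 addr0.
Qed.

Lemma qalg_vecm x : (0 < m)%N -> pmu q (vec m.+1) x = 0.
Proof.
move=> m0; rewrite pmu_qalg !mxE /= eqSS (gtn_eqF (ltnSn m)) mul0r mulr0 scale0r addr0.
rewrite [x]col_sum_ebas /pmu bil_sumr big1 // => i _; rewrite bilZr ebas_vec -/(pmu _ _ _).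
by rewrite fil_vec // (_ : _ <= _ = false)%N ?scale0r ?scaler0 //; lia.
Qed.

Lemma qalg_vecn x : pmu q (vec m.+2) x = (al * x ord_max 0) *: vec m.+1.
Proof.
rewrite pmu_qalg !mxE /= eqxx mul1r.
rewrite {1}[x]col_sum_ebas /pmu bil_sumr big1 ?add0r // => i _.
rewrite bilZr ebas_vec -/(pmu _ _ _).
by rewrite fil_vec // (_ : _ <= _ = false)%N ?scale0r ?scaler0 //; lia.
Qed.

Lemma qalgC x y : pmu q x y = pmu q y x.
Proof. by rewrite !pmu_qalg filC [y _ _ * _]mulrC. Qed.

(** [al * de = 0] is what Leibniz asks. A product of two vectors has no component along [e_1] or
    [e_n], so its brackets vanish; the other side vanishes once [ga e_(n-1) + de e_n] annihilates
    the algebra, and its products are multiples of [al * de]. *)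
Lemma qalg_poisson : (0 < m)%N -> al * de = 0 -> is_poisson q.
Proof.
move=> m0 alde; split=> [|x y z|x|x y z|x y z].
- exact: qalgC.
- have fil_q u v : fil u v = pmu q u v - (al * (u ord_max 0 * v ord_max 0)) *: vec m.+1.
    by rewrite pmu_qalg addrK.
  rewrite [LHS]pmu_qalg [RHS]pmu_qalg !qalg_top mul0r mulr0 !mulr0 !scale0r !addr0.
  have fil_vecm u c : fil (c *: vec m.+1) u = 0.
    rewrite /pmu bilZl -/(pmu _ _ _) fil_q qalg_vecm // mxE /= eqSS.
    by rewrite (gtn_eqF (ltnSn m)) mul0r mulr0 scale0r subr0 scaler0.
  rewrite !pmu_qalg {1}/pmu bilDl -!/(pmu _ _ _) fil_vecm addr0.
  by rewrite [in RHS]/pmu bilDr -!/(pmu _ _ _) [X in _ = _ + X]filC fil_vecm addr0 filA.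
- by rewrite pbr_qalg mulrC subrr scale0r.
- rewrite !pbr_qalg !mxE /= !eqxx !eqSS (gtn_eqF (ltnSn m)) (ltn_eqF m0) /=.
  by rewrite -!scalerDl [X in X *: _](_ : _ = 0) ?scale0r //; ring.
rewrite !pbr_qalg qalg_low // qalg_top !mul0r subrr scale0r.
have w0 t : pmu q (ga *: vec m.+1 + de *: vec m.+2) t = 0.
  rewrite /pmu bilDl !bilZl -!/(pmu _ _ _) qalg_vecm // qalg_vecn.
  by rewrite scaler0 add0r scalerA mulrA [de * _]mulrC alde mul0r scale0r.
by rewrite [X in _ = _ + X]qalgC /pmu !bilZl -!/(pmu _ _ _) !w0 !scaler0 addr0.
Qed.

(** One product already removes the [e_n] component, which silences the [al] term; from then on only
    the filiform part acts, and each factor raises the degree. *)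
Lemma qalg_nil x y : (0 < m)%N -> iter m.+1 (pmu q x) y = 0.
Proof.
move=> m0.
have low d : iter d.+1 (pmu q x) y ord_max 0 = 0 /\
    forall k : 'I_m.+2, (k < d.+1)%N -> iter d.+1 (pmu q x) y k 0 = 0.
  elim: d => [|d [IHtop IHlow]]; rewrite iterS; split; rewrite ?qalg_top // => k lt_k.
    by rewrite (_ : k = 0) ?qalg_low //; apply/val_inj => /=; lia.
  rewrite pmu_qalg mxE IHtop !mulr0 scale0r [X in _ + X]mxE addr0.
  exact: fil_low IHlow _ lt_k.
have [top lo] := low m; apply/colP => k; rewrite [in RHS]mxE.
have [/lo//|le_mk] := ltnP k m.+1.
by rewrite (_ : k = ord_max) //; apply/val_inj => /=; have := ltn_ord k; lia.
Qed.

End Qalg.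

Lemma palg_P0 n : palg n P0 = filalg n n.
Proof. by []. Qed.

(** All three constants vanish for [P11]. The triple at [P0] is a filler: that algebra is not of the
    form [qalg]. *)
Definition qpar (A : alg) : C * C * C :=
  match A with
  | P12 => (0, 0, 1) | P13 => (0, 1, 0) | P14 => (1, 0, 0) | P15 => (1, 1, 0)
  | _ => (0, 0, 0)
  end.

Lemma palg_qalg m A : A <> P0 ->
  palg m.+2 A = qalg m (qpar A).1.1 (qpar A).1.2 (qpar A).2.
Proof.
case: A => // _; apply: functional_extensionality => -[[[[] i] j] k] /=;
by rewrite /kd /=; ring.
Qed.

(** * Recognizing the algebras *)

Section Frame.
Variable n : nat.
Implicit Types (w : nat -> 'cV[C]_n.+1) (y z : 'cV[C]_n.+1) (a : nat -> C).

Definition frame w y : 'M[C]_n.+1 := \matrix_(k, j) (if (j < n)%N then w j else y) k 0.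

Lemma frame_ebas w y (j : 'I_n.+1) : frame w y *m ebas j = if (j < n)%N then w j else y.
Proof. by apply/colP => k; rewrite -colE !mxE. Qed.

Lemma frame_mul w y a d :
  frame w y *m (\col_j if (j < n)%N then a j else d) = \sum_(j < n) a j *: w j + d *: y.
Proof.
apply/colP => k; rewrite !mxE big_ord_recr /= !mxE ltnn summxE mulrC; congr (_ + _).
by apply: eq_bigr => j _; rewrite !mxE /= ltn_ord mulrC.
Qed.

Lemma frame_span w y z : frame w y \in unitmx ->
  exists a d, z = \sum_(j < n) a j *: w j + d *: y.
Proof.
move=> uf; pose x := invmx (frame w y) *m z; exists (fun j => x (inord j) 0), (x ord_max 0).
rewrite -(frame_mul w y (fun j => x (inord j) 0)) -[LHS](mulKVmx uf z) -/x.
congr (_ *m _); apply/colP => j; rewrite [RHS]mxE; case: ltnP => le_nj; rewrite ?inord_val //.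
by congr (_ _ 0); apply/val_inj => /=; have := ltn_ord j; lia.
Qed.

Lemma frame_free w y a d : frame w y \in unitmx -> \sum_(j < n) a j *: w j + d *: y = 0 ->
  (forall j, (j < n)%N -> a j = 0) /\ d = 0.
Proof.
move=> uf; rewrite -frame_mul => /(congr1 (mulmx (invmx (frame w y)))).
rewrite mulKmx // mulmx0 => /colP e0; split=> [j lt_jn|].
  by have := e0 (inord j); rewrite !mxE inordK ?lt_jn // ltnW.
by have := e0 ord_max; rewrite !mxE ltnn.
Qed.

Lemma frame_unit w y :
  (forall a d, \sum_(j < n) a j *: w j + d *: y = 0 -> (forall j, (j < n)%N -> a j = 0) /\ d = 0) ->
  frame w y \in unitmx.
Proof.
move=> free; rewrite -unitmx_tr unitmxE unitfE; apply/negP => /det0P[x x0].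
move/(congr1 trmx); rewrite trmx_mul trmxK trmx0 => fx0; case/eqP: x0.
have xE : x^T = \col_j if (j < n)%N then x 0 (inord j) else x 0 ord_max.
  apply/colP => j; rewrite !mxE; case: ltnP => le_nj; rewrite ?inord_val //.
  by congr (_ 0 _); apply/val_inj => /=; have := ltn_ord j; lia.
move: fx0; rewrite xE (frame_mul _ _ (fun j => x 0 (inord j))).
case/(free (fun j => x 0 (inord j))) => x0 xn.
apply/rowP => j; rewrite mxE; have [/x0|le_nj] := ltnP j n; first by rewrite inord_val.
by rewrite -[RHS]xn; congr (_ 0 _); apply/val_inj => /=; have := ltn_ord j; lia.
Qed.

End Frame.

Section Powers.
Variable n : nat.
Variables (u : pstruct n) (v : 'cV[C]_n).
Implicit Types (x y z : 'cV[C]_n).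
Local Notation mul := (pmu u).
Local Notation br := (pbr u).

(* [pw k] is the power [v ^ (k + 1)]. *)
Definition pw k := iter k (mul v) v.

Lemma pwS k : pw k.+1 = mul v (pw k). Proof. by []. Qed.

Lemma iter_mulD x k y z : iter k (mul x) (y + z) = iter k (mul x) y + iter k (mul x) z.
Proof. by elim: k => //= k ->; rewrite /pmu bilDr. Qed.

Lemma iter_mulZ x k c y : iter k (mul x) (c *: y) = c *: iter k (mul x) y.
Proof. by elim: k => //= k ->; rewrite /pmu bilZr. Qed.

Lemma iter_mul0 x k : iter k (mul x) 0 = 0.
Proof. by elim: k => //= k ->; rewrite /pmu bil0r. Qed.

Lemma iter_mul_sum x k J (r : seq J) (F : J -> 'cV[C]_n) :
  iter k (mul x) (\sum_(j <- r) F j) = \sum_(j <- r) iter k (mul x) (F j).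
Proof. exact: (big_morph _ (iter_mulD x k) (iter_mul0 x k)). Qed.

Lemma iter_pw k j : iter k (mul v) (pw j) = pw (k + j).
Proof. by rewrite /pw iterD. Qed.

Lemma pw_ge0 d j : pw d = 0 -> (d <= j)%N -> pw j = 0.
Proof. by move=> pd /subnK <-; rewrite -iter_pw pd iter_mul0. Qed.

Hypothesis Pu : is_poisson u.

Lemma mulC x y : mul x y = mul y x. Proof. by case: Pu. Qed.
Lemma mulA x y z : mul (mul x y) z = mul x (mul y z). Proof. by case: Pu. Qed.
Lemma mulCA x y z : mul x (mul y z) = mul y (mul x z).
Proof. by rewrite -!mulA [mul x y]mulC. Qed.

Lemma brC x y : br x y = - br y x.
Proof.
case: Pu => _ _ br0 _ _; apply/eqP; rewrite -addr_eq0; apply/eqP.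
by have := br0 (x + y); rewrite /pbr bilDl !bilDr -!/(pbr _ _ _) !br0 add0r addr0.
Qed.

Lemma br_mul x y z : br (mul x y) z = mul (br x z) y + mul x (br y z).
Proof. by case: Pu. Qed.

Lemma mul_iter x k y z : mul x (iter k (mul y) z) = iter k (mul y) (mul x z).
Proof. by elim: k => //= k <-; rewrite mulCA. Qed.

Lemma pw_mul i j : mul (pw i) (pw j) = pw (i + j).+1.
Proof. by elim: i => //= i IHi; rewrite mulA IHi. Qed.

Lemma mul_pw_eq0 x j : mul v x = 0 -> mul x (pw j) = 0.
Proof. by move=> vx; rewrite mul_iter mulC vx iter_mul0. Qed.

(** By Leibniz the bracket with [x] is a derivation, so it kills the powers of [v] as soon as it
    kills [v]. *)
Lemma br_pw_v x i : br v x = 0 -> br (pw i) x = 0.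
Proof. by move=> vx; elim: i => //= i IHi; rewrite br_mul vx IHi /pmu bil0l bil0r addr0. Qed.

Lemma br_pw i j : br (pw i) (pw j) = 0.
Proof.
apply: br_pw_v; rewrite brC br_pw_v ?oppr0 //; by case: Pu.
Qed.

End Powers.

(** In a relation among the powers whose coefficients below index [j] are known to vanish,
    multiplying [n - j] times by [v] leaves only the term of index [j]. In the resulting basis the
    products are forced, and powers of [v] have zero brackets. *)
Lemma filalg_presentation n (u : pstruct n.+1) (v : 'cV[C]_n.+1) : is_poisson u ->
  pw u v n != 0 -> pw u v n.+1 = 0 ->
  frame (pw u v) (pw u v n) \in unitmx /\
  u = act (frame (pw u v) (pw u v n)) (filalg n.+1 n.+1).
Proof.
move=> Pu pn0 pn1; set g := frame _ _.
have gE (j : 'I_n.+1) : g *m ebas j = pw u v j.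
  rewrite frame_ebas; case: ltnP => // le_nj; congr (pw u v _).
  by have := ltn_ord j; lia.
have gvec k : (0 < k)%N -> g *m vec k = pw u v k.-1.
  case: k => // k _; have [lt_kn|le_nk] := ltnP k n.+1; last first.
    by rewrite vec_gt // mulmx0 (pw_ge0 pn1).
  by rewrite -(ebas_vec (Ordinal lt_kn)) gE.
have ug : g \in unitmx.
  apply: frame_unit => a d.
  pose b j := if (j < n)%N then a j else d.
  have -> : \sum_(j < n) a j *: pw u v j + d *: pw u v n = \sum_(j < n.+1) b j *: pw u v j.
    rewrite big_ord_recr /= {2}/b ltnn; congr (_ + _).
    by apply: eq_bigr => j _; rewrite /b ltn_ord.
  move=> sb0; suff b0 j : (j < n.+1)%N -> b j = 0.
    split=> [j lt_jn|]; last by have := b0 n (ltnSn n); rewrite /b ltnn.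
    by have := b0 j (ltnW lt_jn); rewrite /b lt_jn.
  elim/ltn_ind: j => j IHj lt_jn.
  have := congr1 (iter (n - j) (pmu u v)) sb0; rewrite iter_mul_sum iter_mul0.
  rewrite (bigD1 (Ordinal lt_jn)) //= big1 ?addr0 => [|i ne_ij].
    rewrite iter_mulZ iter_pw subnK // => /eqP; rewrite scaler_eq0 (negbTE pn0) orbF.
    by move/eqP.
  rewrite iter_mulZ iter_pw; have [lt_ij|le_ji] := ltnP i j.
    by rewrite IHj ?scale0r // (ltn_trans lt_ij).
  rewrite (pw_ge0 pn1) ?scaler0 //; have : (i != j :> nat) by []; lia.
split=> //; apply: eq_act => // -[] i j; rewrite !gE.
  by rewrite -!/(pbr _ _ _) fil_pbr br_pw // mulmx0.
rewrite -!/(pmu _ _ _) !ebas_vec fil_vec // pw_mul // -scalemxAr gvec //.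
have -> : (i.+1 + j.+1).-1 = (i + j).+1 by lia.
rewrite scale_bool; case: ifP => // /negbT; rewrite -ltnNge => gt_ij.
by rewrite (pw_ge0 pn1) // -addSn -ltnS -addnS.
Qed.

Section Qpresentation.
Variable m : nat.
Variables (u : pstruct m.+2) (v y : 'cV[C]_m.+2).
Hypothesis Pu : is_poisson u.
Hypothesis pm : pw u v m.+1 = 0.
Local Notation mul := (pmu u).
Local Notation br := (pbr u).
Local Notation pw := (pw u v).
Local Notation g := (frame pw y).
Hypothesis ug : g \in unitmx.

(** The three relations force the rest of the table: [v y = 0] gives [y v^j = 0] for all [j >= 1],
    so [{v, y}] annihilates the powers of [v], and Leibniz then kills [{v^j, y}] for [j > 1]. *)
Lemma qalg_presentation al ga de : mul v y = 0 -> mul y y = al *: pw m ->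
  br v y = ga *: pw m + de *: y -> (0 < m)%N ->
  u = act g (qalg m al ga de).
Proof.
move=> vy yy bvy m0.
have gvec k : (0 < k)%N -> (k <= m.+2)%N -> g *m vec k = if (k == m.+2) then y else pw k.-1.
  case: k => // k _ lt_kn; rewrite -(ebas_vec (Ordinal lt_kn)) frame_ebas /=.
  by case: ltnP => lt_km; case: eqP => //; lia.
have gvec1 k : (0 < k)%N -> (k <= m.+1)%N -> g *m vec k = pw k.-1.
  by move=> k0 le_k; rewrite gvec ?(leqW le_k) // ltn_eqF // ltnS.
have yp j : mul y (pw j) = 0 by rewrite (mul_pw_eq0 Pu).
have wp j : mul (ga *: pw m + de *: y) (pw j) = 0.
  rewrite /pmu bilDl !bilZl -!/(pmu _ _ _) yp (pw_mul _ Pu) (pw_ge0 pm) ?scaler0 ?addr0 //.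
  by rewrite ltnS leq_addr.
have bpy j : br (pw j.+1) y = 0.
  elim: j => [|j IHj]; rewrite pwS (br_mul Pu) bvy wp add0r; last by rewrite IHj /pmu bil0r.
  by rewrite (mulC Pu); apply: (wp 0%N).
have bpy0 j : br (pw j) y = (j == 0)%:R *: (ga *: pw m + de *: y).
  by case: j => [|j]; rewrite scale_bool ?bpy.
have gW : g *m (ga *: vec m.+1 + de *: vec m.+2) = ga *: pw m + de *: y.
  by rewrite mulmxDr -!scalemxAr gvec1 // gvec // eqxx.
have maxE (i : 'I_m.+2) : (m < i)%N -> i = ord_max.
  by move=> lt_mi; apply/val_inj => /=; have := ltn_ord i; lia.
apply: eq_act => // b i j; rewrite !frame_ebas.
have nmax (k : 'I_m.+2) : (k < m.+1)%N -> (ord_max == k) = false.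
  by move=> lt_k; apply/negbTE; rewrite neq_ltn /= lt_k orbT.
have n0max : (0 == ord_max :> 'I_m.+2) = false by [].
case: b; rewrite -?/(pmu _ _ _) -?/(pbr _ _ _).
  rewrite pbr_qalg -scalemxAr gW !mxE !andbT.
  have [lt_i|/maxE ->] := ltnP i m.+1; have [lt_j|/maxE ->] := ltnP j m.+1.
  - by rewrite !nmax // mulr0 mul0r subrr scale0r br_pw.
  - by rewrite (nmax i) // eqxx mulr1 mul0r subr0 bpy0 eq_sym.
  - by rewrite n0max eqxx mul0r mul1r sub0r scaleNr (brC Pu) bpy0 eq_sym.
  - by rewrite n0max mul0r mulr0 subrr scale0r; case: Pu.
rewrite pmu_qalg mulmxDr -scalemxAr gvec1 // !mxE !andbT !ebas_vec fil_vec // -scalemxAr.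
have [lt_i|/maxE ->] := ltnP i m.+1; have [lt_j|/maxE ->] := ltnP j m.+1.
- rewrite !nmax // !mulr0 scale0r addr0 (pw_mul _ Pu) scale_bool.
  case: ifP => [le_ij|/negbT]; first by rewrite gvec1 // addnS addSn.
  by rewrite -ltnNge => gt_ij; rewrite (pw_ge0 pm) // -addSn -ltnS -addnS.
- rewrite (nmax i) // mul0r mulr0 scale0r addr0 (mulC Pu) yp.
  by rewrite scale_bool ifN ?scale0r // -ltnNge /=; lia.
- rewrite (nmax j) // !mulr0 scale0r addr0 yp.
  by rewrite scale_bool ifN ?scale0r // -ltnNge /=; lia.
rewrite eqxx !mulr1 yy scale_bool ifN ?add0r // -ltnNge /=; lia.
Qed.

End Qpresentation.

Section Qrecognition.
Variable m : nat.
Variables (u : pstruct m.+2) (v y : 'cV[C]_m.+2).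
Hypothesis Pu : is_poisson u.
Hypothesis nil : forall x z, iter m.+2 (pmu u x) z = 0.
Hypothesis pm : pw u v m.+1 = 0.
Local Notation mul := (pmu u).
Local Notation br := (pbr u).
Local Notation pw := (pw u v).
Implicit Types (x z : 'cV[C]_m.+2) (a : nat -> C).

Lemma sum_nat_recl (F : nat -> 'cV[C]_m.+2) k :
  \sum_(j < k.+1) F j = F 0%N + \sum_(j < k) F j.+1.
Proof. by rewrite big_ord_recl. Qed.

Lemma mul_span a : mul v (\sum_(j < m.+1) a j *: pw j) = \sum_(j < m) a j *: pw j.+1.
Proof.
rewrite big_ord_recr /= /pmu bilDr bilZr -!/(pmu _ _ _) -pwS pm scaler0 addr0 /pmu bil_sumr.
by apply: eq_bigr => j _; rewrite bilZr.
Qed.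

Lemma pw_neq0 z : frame pw z \in unitmx -> pw m != 0.
Proof.
move=> uf; apply/eqP => pm0; have := frame_free (a := fun j => (j == m)%:R) (d := 0) uf.
rewrite big_ord_recr /= pm0 scaler0 !addr0 scale0r addr0 big1 => [|j _]; last first.
  by rewrite ltn_eqF ?scale0r.
by case=> // /(_ m (ltnSn m)) /eqP; rewrite eqxx oner_eq0.
Qed.

(* [mul v] and [mul z] are nilpotent, so [v z] has no component along [z] nor along [v]. *)
Lemma mul_frame z : frame pw z \in unitmx ->
  exists a, mul v z = \sum_(j < m) a j *: pw j.+1.
Proof.
move=> uf; have [a [d vz]] := frame_span (mul v z) uf.
have d0 : d = 0.
  have iter_span k : exists a', iter k (mul v) z = \sum_(j < m.+1) a' j *: pw j + d ^+ k *: z.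
    elim: k => [|k [a' IHk]].
      by exists (fun=> 0); rewrite big1 ?add0r ?scale1r // => j _; rewrite scale0r.
    exists (fun j => (if j is j'.+1 then a' j' else 0) + d ^+ k * a j).
    rewrite iterS IHk {1}/pmu bilDr bilZr -!/(pmu _ _ _) mul_span vz scalerDr scalerA -exprSr addrA.
    congr (_ + _); rewrite scaler_sumr; under [RHS]eq_bigr do rewrite scalerDl -scalerA.
    rewrite [RHS]big_split (sum_nat_recl (fun j => (if j is j'.+1 then a' j' else 0) *: pw j)) /=.
    by rewrite scale0r add0r.
  have := nil v z; have [a' ->] := iter_span m.+2 => /(frame_free uf)[_ /eqP].
  by rewrite expf_eq0 => /andP[_ /eqP].
move: vz; rewrite d0 scale0r addr0 (sum_nat_recl (fun j => a j *: pw j)) => vz.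
have zpm : mul z (pw m) = a 0%N *: pw m.
  rewrite (mul_iter Pu) (mulC Pu) vz iter_mulD iter_mulZ iter_mul_sum big1 ?addr0 // => j _.
  by rewrite iter_mulZ iter_pw (pw_ge0 pm) ?scaler0 // addnS ltnS leq_addr.
have iter_zpm k : iter k (mul z) (pw m) = a 0%N ^+ k *: pw m.
  elim: k => [|k IHk]; rewrite ?scale1r // iterS IHk /pmu bilZr -/(pmu _ _ _) zpm.
  by rewrite scalerA exprSr.
have a0 : a 0%N = 0.
  have /eqP := nil z (pw m); rewrite iter_zpm scaler_eq0 (negbTE (pw_neq0 uf)) orbF.
  by rewrite expf_eq0 => /andP[_ /eqP].
exists (fun j => a j.+1); rewrite vz a0 scale0r add0r.
by apply: eq_bigr => j _.
Qed.

Lemma frame_shift z (b : nat -> C) : frame pw z \in unitmx ->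
  frame pw (z + \sum_(j < m) b j *: pw j) \in unitmx.
Proof.
move=> uf; apply: frame_unit => a d; pose b' j := if (j < m)%N then b j else 0.
have -> : \sum_(j < m) b j *: pw j = \sum_(j < m.+1) b' j *: pw j.
  rewrite big_ord_recr /= {2}/b' ltnn scale0r addr0.
  by apply: eq_bigr => j _; rewrite /b' ltn_ord.
rewrite scalerDr [d *: z + _]addrC addrA scaler_sumr -big_split /=.
under eq_bigr do rewrite scalerA -scalerDl.
case/(frame_free (a := fun j => a j + d * b' j) uf) => ab d0; split=> // j lt_j.
by have := ab j lt_j; rewrite d0 mul0r addr0.
Qed.

(** Multiplication by [v] shifts the powers and kills [y'], so only the last power and [y'] remain
    in its kernel. Both [y' y'] and [{v, y'}] are located in this way. *)
Lemma mul_ker y' z : frame pw y' \in unitmx -> mul v y' = 0 -> mul v z = 0 ->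
  exists ga de, z = ga *: pw m + de *: y'.
Proof.
move=> uf vy vz; have [a [d zE]] := frame_span z uf; exists (a m), d.
rewrite zE big_ord_recr /= big1 ?add0r // => j _.
move: vz; rewrite zE {1}/pmu bilDr bilZr -!/(pmu _ _ _) vy scaler0 addr0 mul_span => s0.
have := frame_free (a := fun j => if j is j'.+1 then a j' else 0) (d := 0) uf.
rewrite (sum_nat_recl (fun j => (if j is j'.+1 then a j' else 0) *: pw j)) /=.
rewrite !scale0r add0r addr0 => /(_ s0)[/(_ j.+1) + _].
by rewrite ltnS => /(_ (ltn_ord j)) ->; rewrite scale0r.
Qed.

(** Subtracting from [y] the combination of powers with the same product by [v] gives [v y' = 0].
    Then [y' y'] lies in the kernel of [v] by associativity, and [{v, y'}] does by Leibniz applied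
    to [{v y', v} = 0]; nilpotency removes the component of [y' y'] along [y']. The shift uses [m]
    powers only, which matters for counting parameters. *)
Lemma qalg_recognition : (0 < m)%N -> frame pw y \in unitmx ->
  exists (b : nat -> C) al ga de, [/\ al * de = 0,
    frame pw (y + \sum_(j < m) b j *: pw j) \in unitmx &
    u = act (frame pw (y + \sum_(j < m) b j *: pw j)) (qalg m al ga de)].
Proof.
move=> m0 uf; have [c vy] := mul_frame uf; exists (fun j => - c j).
have uf' := frame_shift (fun j => - c j) uf.
set y' := y + _ in uf' *.
have vy' : mul v y' = 0.
  rewrite {1}/pmu bilDr bil_sumr -/(pmu _ _ _) vy -big_split big1 // => j _ /=.
  by rewrite bilZr -/(pmu _ _ _) -pwS scaleNr subrr.
have yp j : mul y' (pw j) = 0 by rewrite (mul_pw_eq0 Pu).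
have [al [be yy]] : exists al be, mul y' y' = al *: pw m + be *: y'.
  by apply: mul_ker => //; rewrite -(mulA Pu) vy' /pmu bil0l.
have be0 : be = 0.
  have iter_yy k : iter k (mul y') (mul y' y') = be ^+ k *: mul y' y'.
    elim: k => [|k IHk]; rewrite ?scale1r // iterS IHk /pmu bilZr -!/(pmu _ _ _).
    rewrite {1}yy {1}/pmu bilDr !bilZr -!/(pmu _ _ _) yp scaler0 add0r scalerA -exprSr.
    by [].
  have /eqP := nil y' y'; rewrite iterSr iter_yy scaler_eq0 expf_eq0 /= => /orP[/eqP //|/eqP yy0].
  have := frame_free (a := fun j => (j == m)%:R * al) (d := be) uf'.
  rewrite big_ord_recr /= eqxx mul1r big1 ?add0r => [|j _]; last first.
    by rewrite ltn_eqF // mul0r scale0r.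
  by rewrite -yy yy0; case.
rewrite be0 scale0r addr0 in yy.
have vbr : mul v (br y' v) = 0.
  have := br_mul Pu v y' v; rewrite vy' /pbr bil0l -!/(pbr _ _ _).
  have -> : br v v = 0 by case: Pu.
  by rewrite /pmu bil0l add0r.
have [ga [de bvy]] : exists ga de, br v y' = ga *: pw m + de *: y'.
  by apply: mul_ker => //; rewrite (brC Pu) /pmu bilNr -/(pmu _ _ _) vbr oppr0.
exists al, ga, de; split=> //; last exact: qalg_presentation.
(* Leibniz for [{y' y', v}]: the left side is a bracket of powers, hence zero, and the right side is
   [- 2 al de v^(m+1)]. *)
have := br_mul Pu y' y' v; rewrite yy (brC Pu y' v) bvy.
have -> : br (al *: pw m) v = 0 by rewrite /pbr bilZl -/(pbr _ _ _) (br_pw v Pu m 0) scaler0.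
rewrite (mulC Pu _ y') -mulr2n /pmu bilNr bilDr !bilZr -!/(pmu _ _ _) yp yy scaler0 add0r.
rewrite scalerA mulNrn => /esym/eqP; rewrite oppr_eq0 -scaler_nat scalerA scaler_eq0.
rewrite (negbTE (pw_neq0 uf)) orbF mulf_eq0 natC_eq0 /= => /eqP <-.
exact: mulrC.
Qed.

End Qrecognition.

(** * Isomorphisms and degenerations *)

Lemma exists_root k (c : C) : (0 < k)%N -> exists x : C, x ^+ k = c.
Proof.
case: k => // k _; have [x xE] := solve_monicpoly (fun i => if i == 0%N then c else 0) (ltn0Sn k).
exists x; rewrite xE big_ord_recl /= mulr1 big1 ?addr0 // => i _; exact: mul0r.
Qed.

Section Isomorphisms.
Variable m : nat.
Hypothesis m1 : (1 < m)%N.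
Let m0 : (0 < m)%N := ltnW m1.

Lemma qalg_vec al ga de a b : (0 < a)%N -> (0 < b <= m.+1)%N ->
  pmu (qalg m al ga de) (vec a) (vec b) = (a + b <= m.+1)%N%:R *: vec (a + b)%N.
Proof.
move=> a0 /andP[b0 le_b]; rewrite pmu_qalg fil_vec // [vec b ord_max 0]mxE /=.
by rewrite gtn_eqF // !mulr0 scale0r addr0.
Qed.

Lemma pw_qalg al ga de c j : (j <= m)%N ->
  pw (qalg m al ga de) (c *: vec 1) j = c ^+ j.+1 *: vec j.+1.
Proof.
elim: j => [|j IHj] le_j; first by rewrite expr1.
rewrite pwS (IHj (ltnW le_j)) pmuZl pmuZr qalg_vec; last exact: leqW le_j; last by [].
by rewrite scale_bool add1n ltnS le_j scalerA -exprS.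
Qed.

Lemma pw_qalg_top al ga de v : pw (qalg m al ga de) v m.+1 = 0.
Proof. exact: (qalg_nil _ _ _ _ _ m0). Qed.

(** The new generators are [v = a e_1] and [y = c e_n + kap e_(n-1)]; the three equations say that
    [y y] and [{v, y}] have the constants [al'], [ga'], [de'] in the new basis. *)
Lemma qalg_iso al ga de al' ga' de' a c kap : al * de = 0 -> a != 0 -> c != 0 ->
  al * c ^+ 2 = al' * a ^+ m.+1 -> ga' * a ^+ m.+1 + de' * kap = a * c * ga ->
  de' = a * de -> gorbit (qalg m al' ga' de') (qalg m al ga de).
Proof.
move=> alde a0 c0 alE gaE deE; set q := qalg m al ga de.
pose v : 'cV[C]_m.+2 := a *: vec 1.
pose y : 'cV[C]_m.+2 := c *: vec m.+2 + kap *: vec m.+1.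
have pE j : (j <= m)%N -> pw q v j = a ^+ j.+1 *: vec j.+1 by apply: pw_qalg.
have vm x : pmu q x (vec m.+1) = 0 by rewrite qalgC qalg_vecm.
have free (b : nat -> C) d : \sum_(j < m.+1) b j *: pw q v j + d *: y = 0 ->
    (forall j, (j < m.+1)%N -> b j = 0) /\ d = 0.
  move=> s0.
  have dE : d * c = 0.
    have /colP/(_ ord_max) := s0; rewrite mxE summxE big1 => [|j _].
      by rewrite !mxE /= !eqxx eqSS (gtn_eqF (ltnSn m)) mulr1 mulr0 addr0 add0r.
    by rewrite (pE _ (ltn_ord j)) !mxE /= eqSS gtn_eqF ?mulr0.
  have d0 : d = 0 by move/eqP: dE; rewrite mulf_eq0 (negbTE c0) orbF => /eqP.
  split=> // j lt_j; have lt_j2 := leqW lt_j; have /colP/(_ (inord j)) := s0.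
  rewrite d0 scale0r addr0 summxE (bigD1 (Ordinal lt_j)) //= big1 => [|i ne_ij].
    rewrite (pE _ lt_j) !mxE inordK // eqxx mulr1 addr0 => /eqP.
    by rewrite mulf_eq0 expf_eq0 (negbTE a0) orbF => /eqP.
  rewrite (pE _ (ltn_ord i)) !mxE inordK // eqSS (_ : (j == i) = false) ?mulr0 //.
  by apply: contraNF ne_ij => /eqP eji; apply/eqP/val_inj.
exists (frame (pw q v) y); first exact: frame_unit.
have yE k : (k <= m)%N -> pmu q y (vec k.+1) = 0.
  move=> le_km; rewrite pmuDl !pmuZl qalg_vecn qalg_vecm // mxE /=.
  by rewrite eqSS (gtn_eqF (le_km : k < m.+1)%N) mulr0 scale0r !scaler0 addr0.
apply: qalg_presentation => //.
- exact: qalg_poisson.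
- exact: pw_qalg_top.
- exact: frame_unit.
- by rewrite qalgC pmuZr yE // scaler0.
- rewrite {2}/y pmuDr !pmuZr (yE m) // scaler0 addr0 qalgC.
  rewrite qalg_vecn !mxE /= eqxx eqSS (gtn_eqF (ltnSn m)) mulr1 mulr0 addr0.
  by rewrite pE // !scalerA -alE; congr (_ *: _); ring.
rewrite pbr_qalg !mxE /= !eqxx eqSS (gtn_eqF (ltnSn m)) eqSS (ltn_eqF m0).
rewrite pE // (_ : _ - _ = a * c); last by rewrite /=; ring.
rewrite /y !scalerDr !scalerA [_ *: vec m.+2 + _ *: vec m.+1]addrC addrA -scalerDl gaE deE.
by congr (_ *: _ + _ *: _); ring.
Qed.

(** Meant for [al * de = 0], so that [de = 0] in the branch [al != 0]. When [de != 0], [ga] is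
    absorbed by a change of basis. *)
Definition qnormal (al ga de : C) : alg :=
  if al != 0 then if ga != 0 then P15 else P14
  else if de != 0 then P12 else if ga != 0 then P13 else P11.

Lemma qnormalP al ga de : al * de = 0 ->
  gorbit (palg m.+2 (qnormal al ga de)) (qalg m al ga de).
Proof.
move=> alde; rewrite palg_qalg; last by rewrite /qnormal; do !case: ifP.
rewrite /qnormal; have [al0|al_neq0] /= := eqVneq al 0.
  have [de0|de_neq0] /= := eqVneq de 0; last first.
    (* Adding a multiple of [e_(n-1)] to [e_n] makes it an eigenvector of the bracket with [e_1],
       which absorbs [ga]. *)
    apply: (@qalg_iso _ _ _ _ _ _ de^-1 1 (de^-1 * ga)); rewrite ?oner_neq0 ?invr_neq0 //.
    - by rewrite al0; ring.
    - by ring.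
    - by rewrite mulVf.
  have [ga0|ga_neq0] /= := eqVneq ga 0; first by rewrite al0 de0 ga0; apply: gorbit_refl.
  apply: (@qalg_iso _ _ _ _ _ _ 1 ga^-1 0);
    rewrite ?oner_neq0 ?invr_neq0 ?al0 ?de0 ?mul0r ?mulr0 //.
  by rewrite expr1n; field.
have de0 : de = 0 by move/eqP: alde; rewrite mulf_eq0 (negbTE al_neq0) => /eqP.
have [ga0|ga_neq0] /= := eqVneq ga 0.
  have [c c2] := @exists_root 2 al^-1 isT.
  apply: (@qalg_iso _ _ _ _ _ _ 1 c 0); rewrite ?oner_neq0 //.
  - by apply: contraTneq al_neq0 => c0; rewrite -invr_eq0 -c2 c0 expr0n negbK.
  - by rewrite c2 mulfV // expr1n mulr1.
  - by rewrite ga0; ring.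
  - by rewrite de0; ring.
(* With both target constants equal to 1, [al c^2 = a^(m+1)] and [a^(m+1) = a c ga] give
   [c = a^m / ga] and [a^(m-1) = ga^2 / al], solvable because [m > 1]. *)
have [a aE] := @exists_root m.-1 (ga ^+ 2 / al) ltac:(by rewrite -ltnS prednK).
have a0 : a != 0.
  have : a ^+ m.-1 != 0 by rewrite aE mulf_neq0 ?expf_neq0 ?invr_neq0.
  by apply: contraNneq => ->; rewrite expr0n gtn_eqF // -ltnS prednK.
apply: (@qalg_iso _ _ _ _ _ _ a (a ^+ m / ga) 0); rewrite ?mulf_neq0 ?expf_neq0 ?invr_neq0 //.
- have -> : a ^+ m.+1 = a ^+ 2 * a ^+ m.-1 by rewrite -exprD add2n prednK.
  have -> : a ^+ m = a * a ^+ m.-1 by rewrite -exprS prednK.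
  by rewrite aE; field; rewrite al_neq0.
- by rewrite exprS; field.
- by rewrite de0; ring.
Qed.

End Isomorphisms.

(** A polynomial in [t] that is nonzero at [t = 0] is nonzero at some [t != 0], where the curve lies
    in the orbit. *)
Lemma zclosure_curve n (s : pstruct n) (F : C -> pstruct n) :
  (forall k, polyfun (fun x : {ffun unit -> C} => F (x tt) k)) ->
  (forall t, t != 0 -> gorbit s (F t)) -> zclosure (gorbit s) (F 0).
Proof.
move=> pF sF p p0; apply/eqP; apply: contraT => pF0.
have [k [P [pP PE]]] : reg (fun _ : {ffun unit -> C} => 1)
    (fun x : {ffun unit -> C} => p.@[coords (F (x tt))]).
  by apply: (reg_meval (polyfun_const 1)) => i; apply: polyfun_reg; apply: pF.
have PE' x : P x = p.@[coords (F (x tt))] by rewrite -PE ?oner_neq0 // expr1n mul1r.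
have [||x []] := @polyfun_domain _ _ _ [ffun=> 1] [ffun=> 0] (polyfun_coord tt) pP.
- by rewrite ffunE oner_neq0.
- by rewrite PE' ffunE.
by move=> /sF/p0; rewrite PE' => ->; rewrite eqxx.
Qed.

Lemma polyfun_qalg (I : finType) m (al ga de : {ffun I -> C} -> C) k :
  polyfun al -> polyfun ga -> polyfun de ->
  polyfun (fun x : {ffun I -> C} => qalg m (al x) (ga x) (de x) k).
Proof.
move=> pal pga pde; case: k => [[[[] i] j] k] /=.
  apply: polyfunM; first exact: polyfun_const.
  by apply: polyfunD; apply: polyfunM => //; apply: polyfun_const.
apply: polyfunD; first exact: polyfun_const.
by apply: polyfunM => //; apply: polyfun_const.
Qed.

(** * The curve realizing the degeneration [P0 -> P14] *)

Section NullFiliform.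
Variable m : nat.
Local Notation n := m.+2.
Local Notation fil := (pmu (filalg n n)).

Definition col_nat (f : nat -> C) : 'cV[C]_n := \col_k f k.+1.

Lemma fil_vec_const i (k : 'I_n) : (0 < i)%N -> fil (vec i) (const_mx 1) k 0 = (i <= k)%N%:R.
Proof.
move=> i0; have -> : const_mx 1 = \sum_(q < n) vec q.+1 :> 'cV[C]_n.
  rewrite [LHS]col_sum_ebas; apply: eq_bigr => q _.
  by rewrite mxE scale1r ebas_vec.
rewrite /pmu bil_sumr summxE -/(pmu _); under eq_bigr do rewrite fil_vec // scale_bool.
have [le_ik|lt_ki] := leqP i k.
  have lt_q : (k - i < n)%N by have := ltn_ord k; lia.
  rewrite (bigD1 (Ordinal lt_q)) //= big1 ?addr0 => [|q ne_q].
    by rewrite addnS subnKC // ltn_ord mxE eqxx.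
  rewrite (fun_if (fun x : 'cV[C]_n => x k 0)) !mxE; case: ifP => // _.
  by rewrite addnS eqSS; case: eqP => // kE; case/eqP: ne_q; apply/val_inj => /=; lia.
rewrite big1 // => q _; rewrite (fun_if (fun x : 'cV[C]_n => x k 0)) !mxE; case: ifP => // _.
by rewrite ltn_eqF //; lia.
Qed.

(** The index [k] is zero-based: [e_(k+1)] is [e_i e_j] for exactly [k] ordered pairs. *)
Lemma fil_const_const (k : 'I_n) : fil (const_mx 1) (const_mx 1) k 0 = k%:R.
Proof.
have {1}-> : const_mx 1 = \sum_(q < n) vec q.+1 :> 'cV[C]_n.
  rewrite [LHS]col_sum_ebas; apply: eq_bigr => q _.
  by rewrite mxE scale1r ebas_vec.
rewrite /pmu bil_suml summxE -/(pmu _); under eq_bigr do rewrite fil_vec_const //.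
rewrite -natr_sum; congr (_%:R).
have kE : (k = \sum_(q < k) 1 :> nat)%N by rewrite big_const_ord iter_addn_0 mul1n.
rewrite [RHS]kE (big_ord_widen n (fun=> 1%N) (ltnW (ltn_ord k))) [RHS]big_mkcond.
by apply: eq_bigr => q _; case: ltnP.
Qed.

(* Structure constants of the null-filiform algebra in the basis [t^(2i) e_i]
   ([i < n]), [t^(n-1) (e_1 + ... + e_n)]: they are polynomial in [t], and at
   [t = 0] only the products of [qalg m (-1) 0 0] survive. *)
Definition null_curve_coef (t : C) (i j k : nat) : C :=
  if i == n then
    if j == n then if k == n then m.+1%:R * t ^+ m.+1 else - (n - k)%:R * t ^+ (2 * (m.+1 - k))
    else if k == n then t ^+ (2 * j) else if (k <= j)%N then - t ^+ (m.+1 + 2 * (j - k)) else 0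
  else if j == n then
    if k == n then t ^+ (2 * i) else if (k <= i)%N then - t ^+ (m.+1 + 2 * (i - k)) else 0
  else if (i + j < n)%N then (k == i + j)%N%:R
  else if (i + j == n)%N then if k == n then t ^+ n.+1 else - t ^+ (2 * (n - k))
  else 0.

Definition null_curve (t : C) : pstruct n := alg_of n (null_curve_coef t) (fun _ _ _ => 0).

Definition null_frame (t : C) : 'M[C]_n :=
  frame (fun j => t ^+ (2 * j.+1) *: vec j.+1) (t ^+ m.+1 *: const_mx 1).

Lemma null_frame_col t f (k : 'I_n) : (null_frame t *m col_nat f) k 0 =
  if k == ord_max then t ^+ m.+1 * f n else t ^+ (2 * k.+1) * f k.+1 + t ^+ m.+1 * f n.
Proof.
have -> : col_nat f = \col_j if (j < m.+1)%N then f j.+1 else f n.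
  apply/colP => j; rewrite !mxE; case: ltnP => // le_j; congr (f _).
  by have := ltn_ord j; lia.
rewrite (frame_mul _ _ (fun j => f j.+1)) mxE summxE !mxE mulr1 [f n * _]mulrC.
case: eqVneq => [->|ne_k].
  rewrite big1 ?add0r // => j _; rewrite !mxE /= eqSS gtn_eqF ?mulr0 //.
have lt_k : (k < m.+1)%N.
  by move: ne_k; rewrite -(inj_eq val_inj) /=; have := ltn_ord k; lia.
rewrite (bigD1 (Ordinal lt_k)) //= big1 ?addr0 => [|j ne_j].
  by rewrite !mxE eqxx mulr1 mulrC.
rewrite !mxE eqSS (_ : (k == j :> nat) = false) ?mulr0 //.
by apply: contraNF ne_j => /eqP ekj; apply/eqP/val_inj.
Qed.

Lemma null_frame_unit t : t != 0 -> null_frame t \in unitmx.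
Proof.
move=> t0; apply: frame_unit => a d.
rewrite -(@frame_mul m.+1 (fun j => t ^+ (2 * j.+1) *: vec j.+1) (t ^+ m.+1 *: const_mx 1) a d).
rewrite -/(null_frame t).
have -> : (\col_(j < n) if (j < m.+1)%N then a j else d) =
    col_nat (fun k => if (k.-1 < m.+1)%N then a k.-1 else d).
  by apply/colP => j; rewrite !mxE.
move=> /colP f0.
have d0 : d = 0.
  have := f0 ord_max; rewrite null_frame_col eqxx /= ltnn mxE => /eqP.
  by rewrite mulf_eq0 expf_eq0 (negbTE t0) => /eqP.
split=> // j lt_j; have := f0 (inord j); rewrite null_frame_col mxE /= ltnn d0 mulr0 addr0.
rewrite -(inj_eq val_inj) /= inordK ?(leqW lt_j) // (ltn_eqF lt_j) lt_j => /eqP.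
by rewrite mulf_eq0 expf_eq0 (negbTE t0) andbF => /eqP.
Qed.

Lemma null_curve_coefC t i j k : null_curve_coef t i j k = null_curve_coef t j i k.
Proof. by rewrite /null_curve_coef [(j + i)%N]addnC; do 2!case: eqP. Qed.

(** Only the last basis vector has a component along [e_n]. It is therefore used to express [e_n],
    and its other components are subtracted: this is the origin of the negative entries of
    [null_curve_coef]. *)
Lemma null_curve_mul t (i j : 'I_n) : null_frame t *m pmu (null_curve t) (ebas i) (ebas j) =
  fil (null_frame t *m ebas i) (null_frame t *m ebas j).
Proof.
have -> : pmu (null_curve t) (ebas i) (ebas j) = col_nat (null_curve_coef t i.+1 j.+1).
  by apply/colP => k; rewrite /pmu bil_ebas !mxE.
wlog le_ij : i j / (i <= j)%N.
  move=> IH; have [/IH//|/ltnW/IH] := leqP i j; rewrite [RHS]filC => <-.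
  by congr (_ *m _); apply/colP => k; rewrite !mxE null_curve_coefC.
have maxE (k : 'I_n) : (m < k)%N -> k = ord_max.
  by move=> lt_mk; apply/val_inj => /=; have := ltn_ord k; lia.
apply/colP => k; rewrite null_frame_col !frame_ebas /null_curve_coef (eqxx n).
rewrite !(eqSS i m.+1) !(eqSS j m.+1) !(eqSS k m.+1).
have [lt_j|/maxE jE] := ltnP j m.+1; last first.
  rewrite jE eqxx; have [lt_i|/maxE ->] := ltnP i m.+1; last first.
    rewrite ?eqxx pmuZl pmuZr scalerA mxE fil_const_const.
    have [->|ne_k] := eqVneq k ord_max; first by rewrite /=; ring.
    have lt_k : (k < m.+1)%N by rewrite ltnNge; apply: contra ne_k => /maxE ->.
    rewrite (ltn_eqF lt_k) subSS mulNr mulrN mulrCA.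
    have -> : t ^+ (2 * k.+1) * t ^+ (2 * (m.+1 - k.+1)) = t ^+ m.+1 * t ^+ m.+1.
      by rewrite -!exprD; congr (_ ^+ _); lia.
    by rewrite natrB ?(ltnW lt_k) //; ring.
  rewrite (ltn_eqF lt_i) ?eqxx pmuZl pmuZr scalerA mxE fil_vec_const //.
  have [->|ne_k] := eqVneq k ord_max; first by rewrite /= lt_i mulr1 mulrC.
  have lt_k : (k < m.+1)%N by rewrite ltnNge; apply: contra ne_k => /maxE ->.
  rewrite (ltn_eqF lt_k) ltnS; case: (leqP k i) => [le_ki|lt_ik]; last first.
    by rewrite mulr0 add0r mulr1 mulrC.
  rewrite mulr0 mulrN -!exprD; apply/eqP; rewrite addrC subr_eq0; apply/eqP.
  by congr (_ ^+ _); lia.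
have lt_i := leq_ltn_trans le_ij lt_j.
rewrite (ltn_eqF lt_i) (ltn_eqF lt_j) lt_i pmuZl pmuZr scalerA fil_vec // scale_bool.
have [lt_ij|gt_ij|eq_ij] := ltngtP (i.+1 + j.+1)%N n.
- rewrite !mxE [false%:R]/(0 : C) mulr0 addr0.
  have [->|ne_k] := eqVneq k ord_max; first by rewrite /= gtn_eqF ?mulr0.
  case: eqP => [kE|_]; last by rewrite !mulr0.
  by rewrite -exprD; congr (_ ^+ _ * _); lia.
- by rewrite scaler0 mxE; case: ifP => _; rewrite !mulr0 ?addr0.
rewrite !mxE eq_ij (eqSS k m.+1).
have [->|ne_k] := eqVneq k ord_max.
  by rewrite /= eqxx [true%:R]/(1 : C) mulr1 -!exprD; congr (_ ^+ _); lia.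
have lt_k : (k < m.+1)%N by rewrite ltnNge; apply: contra ne_k => /maxE ->.
rewrite (ltn_eqF lt_k) [false%:R]/(0 : C) mulr0 mulrN -!exprD.
apply/eqP; rewrite addrC subr_eq0; apply/eqP.
by congr (_ ^+ _); lia.
Qed.

Lemma null_curve_gorbit t : t != 0 -> gorbit (filalg n n) (null_curve t).
Proof.
move=> t0; apply: gorbit_sym; exists (null_frame t); first exact: null_frame_unit.
apply: eq_act => [|[] i j]; [exact: null_frame_unit| |exact: null_curve_mul].
rewrite -!/(pbr _ _ _) fil_pbr (_ : pbr _ _ _ = 0) ?mulmx0 //.
by apply/colP => k; rewrite /pbr bil_ebas mxE.
Qed.

(** The weights leave exponent zero only at the products with [i + j < n] and at the coefficient
    [-1] of [e_(n-1)] in the square of the last vector. *)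
Lemma null_curve0 : null_curve 0 = qalg m (-1) 0 0.
Proof.
apply: functional_extensionality => -[[[[] i] j] k]; rewrite /= ?(mul0r, mulr0, addr0) //.
have lt_i := ltn_ord i; have lt_j := ltn_ord j; have lt_k := ltn_ord k.
rewrite /null_curve_coef filprodE /kd !eqSS !expr0n /=.
have [ei|ni] := eqVneq (i : nat) m.+1; have [ej|nj] := eqVneq (j : nat) m.+1.
- have -> : (i.+1 + j.+1 <= m.+1)%N = false by apply/negbTE; rewrite -ltnNge; lia.
  rewrite andbF /=; have [ek|nk] := eqVneq (k : nat) m.+1; first by rewrite ek gtn_eqF //=; ring.
  have [ek|nk'] := eqVneq (k : nat) m; last first.
    by rewrite (_ : (2 * _ == 0)%N = false) /=; [ring|apply/eqP; lia].
  by rewrite ek subnn muln0 /= subSn // subnn /=; ring.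
- have -> : (i.+1 + j.+1 <= m.+1)%N = false by apply/negbTE; rewrite -ltnNge; lia.
  by rewrite andbF /=; case: ifP => _; [|case: ifP => _]; ring.
- have -> : (i.+1 + j.+1 <= m.+1)%N = false by apply/negbTE; rewrite -ltnNge; lia.
  by rewrite andbF /=; case: ifP => _; [|case: ifP => _]; ring.
have [le_ij|lt_ij] := leqP (i.+1 + j.+1)%N m.+1.
  by rewrite ltnS le_ij andbT eq_sym /=; ring.
rewrite ltnS leqNgt lt_ij andbF /=; case: ifP => [/eqP eij|_]; last by ring.
have [ek|nk] := eqVneq (k : nat) m.+1; first by ring.
by rewrite (_ : (2 * _ == 0)%N = false) /=; [ring|apply/eqP; lia].
Qed.

Lemma P0_degen_P14 : (1 < m)%N -> zclosure (gorbit (palg n P0)) (palg n P14).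
Proof.
move=> m1; have [g ug ->] : gorbit (qalg m (-1) 0 0) (palg n P14).
  apply: gorbit_sym; have := @qnormalP m m1 (-1) 0 0 (mulr0 _).
  by rewrite /qnormal eqxx oppr_eq0 oner_neq0.
apply: zclosure_act => //; rewrite -null_curve0.
apply: zclosure_curve => [[[[[] i] j] k]|t /null_curve_gorbit //].
  exact: polyfun_const.
have pt e : polyfun (fun x : {ffun unit -> C} => x tt ^+ e) by apply/polyfunX/polyfun_coord.
rewrite /= /null_curve_coef; repeat match goal with |- context [if ?b then _ else _] => case: b end.
all: try exact: pt.
all: try exact: polyfun_const.
all: try by apply/polyfunN/pt.
  by apply: polyfunM => //; apply: polyfun_const.
by apply: polyfunM => //; apply: polyfun_const.
Qed.

End NullFiliform.

(** * Degeneration invariants *)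

Section Invariants.
Variable n : nat.
Implicit Types (s t u : pstruct n) (x y z w : 'cV[C]_n).

Lemma zclosure_polySV (S : pstruct n -> Prop) X t : polySV X ->
  (forall u, S u -> X u = 0) -> zclosure S t -> X t = 0.
Proof.
move=> pX X0 St; apply/colP => i; rewrite [RHS]mxE.
by apply: (zclosure_polyS (pX i) _ St) => u /X0 ->; rewrite mxE.
Qed.

Lemma pmu_act s g x y : g \in unitmx ->
  pmu (act g s) (g *m x) (g *m y) = g *m pmu s x y.
Proof. exact: bil_act_morph. Qed.

Lemma pbr_act s g x y : g \in unitmx ->
  pbr (act g s) (g *m x) (g *m y) = g *m pbr s x y.
Proof. exact: bil_act_morph. Qed.

Lemma poisson_act s g : g \in unitmx -> is_poisson s -> is_poisson (act g s).
Proof.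
move=> ug [sC sA s0 sJ sL].
have gE x : exists x', x = g *m x' by exists (invmx g *m x); rewrite mulKVmx.
split=> [x y|x y z|x|x y z|x y z]; have [{}x ->] := gE x.
- by have [{}y ->] := gE y; rewrite !(pmu_act _ _ _ ug) sC.
- by have [{}y ->] := gE y; have [{}z ->] := gE z; rewrite !(pmu_act _ _ _ ug) sA.
- by rewrite (pbr_act _ _ _ ug) s0 mulmx0.
- have [{}y ->] := gE y; have [{}z ->] := gE z.
  by rewrite !(pbr_act _ _ _ ug) -!mulmxDr sJ mulmx0.
have [{}y ->] := gE y; have [{}z ->] := gE z.
by rewrite !(pbr_act _ _ _ ug, pmu_act _ _ _ ug) -mulmxDr sL.
Qed.

Lemma iter_act s g k x y : g \in unitmx ->
  iter k (pmu (act g s) (g *m x)) (g *m y) = g *m iter k (pmu s x) y.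
Proof. by move=> ug; elim: k => //= k ->; rewrite pmu_act. Qed.

Definition br_zero s := forall x y, pbr s x y = 0.
Definition ad_sq_zero s := forall x y, pbr s x (pbr s x y) = 0.
Definition mul_nil k s := forall x y, iter k (pmu s x) y = 0.

Definition mulform (f : 'rV[C]_n) s : 'M[C]_n :=
  \matrix_(i, j) (f *m pmu s (ebas i) (ebas j)) 0 0.

(* Every form [f (x * y)] has corank at least 2: it stays degenerate after any
   rank one modification. *)
Definition form_corank2 s := forall (f : 'rV[C]_n) (w : 'cV[C]_n) (l : 'rV[C]_n),
  \det (mulform f s + w *m l) = 0.

Lemma degen_br_zero s t : degen s t -> br_zero s -> br_zero t.
Proof.
move=> /degenP st s0 x y; apply: (zclosure_polySV (X := fun u => pbr u x y) _ _ st).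
  by apply: polySV_bil; apply: polySV_const.
move=> _ [g ug ->]; rewrite -[x](mulKVmx ug) -[y](mulKVmx ug) (pbr_act _ _ _ ug).
by rewrite s0 mulmx0.
Qed.

Lemma degen_ad_sq_zero s t : degen s t -> ad_sq_zero s -> ad_sq_zero t.
Proof.
move=> /degenP st s0 x y.
apply: (zclosure_polySV (X := fun u => pbr u x (pbr u x y)) _ _ st).
  by do 2![apply: polySV_bil; first exact: polySV_const]; apply: polySV_const.
move=> _ [g ug ->]; rewrite -[x](mulKVmx ug) -[y](mulKVmx ug) !(pbr_act _ _ _ ug).
by rewrite s0 mulmx0.
Qed.

Lemma degen_mul_nil k s t : degen s t -> mul_nil k s -> mul_nil k t.
Proof.
move=> /degenP st s0 x y.
apply: (zclosure_polySV (X := fun u => iter k (pmu u x) y) _ _ st).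
  by apply: polySV_iter; apply: polySV_const.
by move=> _ [g ug ->]; rewrite -[x](mulKVmx ug) -[y](mulKVmx ug) iter_act // s0 mulmx0.
Qed.

(** The annihilators [a] and [b] span a plane in the radical of every form. Some nonzero vector of
    this plane is orthogonal to [w], so its transpose kills the modified matrix from the left. *)
Lemma form_corank2_of_ann s a b : (forall y, pmu s a y = 0) -> (forall y, pmu s b y = 0) ->
  (forall c d, c *: a + d *: b = 0 -> c = 0 /\ d = 0) -> form_corank2 s.
Proof.
move=> a0 b0 ab f w l.
have [x [x0 xs xw]] : exists x, [/\ x != 0, forall y, pmu s x y = 0 & x^T *m w = 0].
  pose p := (a^T *m w) 0 0; pose q := (b^T *m w) 0 0.
  have pE : a^T *m w = p%:M by apply: mx11_scalar.
  have qE : b^T *m w = q%:M by apply: mx11_scalar.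
  have [p0|p_neq0] := eqVneq p 0.
    exists a; split=> //; last by rewrite pE p0 raddf0.
    apply/eqP => a_eq0; have [|/eqP] := ab 1 0; first by rewrite a_eq0 scaler0 scale0r addr0.
    by rewrite oner_eq0.
  exists (q *: a + (- p) *: b); split.
  - by apply/eqP => /ab[_ /eqP]; rewrite oppr_eq0 (negbTE p_neq0).
  - by move=> y; rewrite pmuDl !pmuZl a0 b0 !scaler0 addr0.
  rewrite linearD !linearZ /= mulmxDl -!scalemxAl pE qE !scale_scalar_mx -raddfD /=.
  by rewrite mulNr mulrC subrr raddf0.
apply/eqP/det0P; exists x^T.
  by apply: contra x0 => /eqP/(congr1 trmx); rewrite trmxK trmx0 => ->.
rewrite mulmxDr mulmxA xw mul0mx addr0; apply/rowP => j; rewrite [RHS]mxE.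
have : f *m pmu s x (ebas j) = 0 by rewrite xs mulmx0.
rewrite {1}[x]col_sum_ebas /pmu bil_suml mulmx_sumr => /matrixP/(_ 0 0); rewrite summxE [in RHS]mxE.
move=> <-; rewrite mxE; apply: eq_bigr => i _; by rewrite bilZl -scalemxAr !mxE.
Qed.

(** For fixed [f], [w], [l] the determinant is polynomial in the structure. The condition is assumed
    on the whole orbit, each member of which has its own pair of annihilators. *)
Lemma degen_form_corank2 s t : degen s t ->
  (forall u, gorbit s u -> form_corank2 u) -> form_corank2 t.
Proof.
move=> /degenP st s2 f w l.
apply: (zclosure_polyS (F := fun u => \det (mulform f u + w *m l)) _ _ st) => [|u /s2 //].
apply: polyS_det => i j.
apply: (@eq_polyS _ (fun u => \sum_k f 0 k * pmu u (ebas i) (ebas j) k 0 + (w *m l) i j)).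
  by move=> u; rewrite !mxE.
apply: polySD; last exact: polyS_const.
apply: polyS_sum => k; apply: polySM; first exact: polyS_const.
by apply: polySV_bil; apply: polySV_const.
Qed.

End Invariants.

(** * The degeneration order among the six algebras *)

Section Classification.
Variable m : nat.
Hypothesis m1 : (1 < m)%N.
Let m0 : (0 < m)%N := ltnW m1.
Local Notation palg := (palg m.+2).

Definition br_zero_alg A := if A is (P0 | P11 | P14) then true else false.
Definition ad_sq_zero_alg A := if A is P12 then false else true.
Definition nil_alg A := if A is P0 then false else true.
Definition corank_alg A := if A is (P14 | P15) then false else true.

Lemma vec_neq0 k : (0 < k <= m.+2)%N -> vec k != 0 :> 'cV[C]_m.+2.
Proof.
move=> /vecP[i _ ->]; apply/eqP => /colP/(_ i)/eqP; rewrite !mxE !eqxx.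
by rewrite oner_eq0.
Qed.

Lemma pbr_qalg1n al ga de :
  pbr (qalg m al ga de) (vec 1) (vec m.+2) = ga *: vec m.+1 + de *: vec m.+2.
Proof. by rewrite pbr_qalg !mxE /= !eqxx mulr1 mul0r subr0 scale1r. Qed.

Lemma qalg_br_zero al : br_zero (qalg m al 0 0).
Proof. by move=> x y; rewrite pbr_qalg !scale0r addr0 scaler0. Qed.

Lemma br_zeroP A : br_zero (palg A) <-> br_zero_alg A.
Proof.
split; last first.
  by case: A => // _; first exact: fil_pbr; rewrite palg_qalg //; apply: qalg_br_zero.
case: A => //; rewrite palg_qalg // => /(_ (vec 1) (vec m.+2)) /eqP;
  rewrite pbr_qalg1n /= ?scale0r ?scale1r ?addr0 ?add0r;
  by rewrite (negbTE (vec_neq0 _)) //= ltnS leqnn ?leqnSn.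
Qed.

Lemma ad_sq_zeroP A : ad_sq_zero (palg A) <-> ad_sq_zero_alg A.
Proof.
have q0 al ga : ad_sq_zero (qalg m al ga 0).
  move=> x y; rewrite !pbr_qalg !mxE /= !eqSS (gtn_eqF (ltnSn m)) (ltn_eqF m0).
  by rewrite !(mulr0, mul0r, addr0, subr0, scale0r).
split; last first.
  by case: A => // _; first (move=> x y; exact: fil_pbr); rewrite palg_qalg //; apply: q0.
case: A => //; rewrite palg_qalg // => /(_ (vec 1) (vec m.+2)) /eqP.
rewrite pbr_qalg1n /= scale0r scale1r add0r pbr_qalg1n scale0r scale1r add0r.
by rewrite (negbTE (vec_neq0 _)) /=.
Qed.

Lemma pw_fil k n (s := filalg n n) : (k < n)%N -> pw s (vec 1) k = vec k.+1.
Proof.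
elim: k => [|k IHk] lt_k //; rewrite pwS IHk ?(ltnW lt_k) // fil_vec // add1n scale_bool.
by rewrite lt_k.
Qed.

Lemma mul_nilP A : mul_nil m.+1 (palg A) <-> nil_alg A.
Proof.
split; last first.
  by case: A => // _ x y; rewrite palg_qalg //; apply: qalg_nil.
case: A => // /(_ (vec 1) (vec 1)); rewrite -/(pw _ _ _) palg_P0 pw_fil // => /eqP.
by rewrite (negbTE (vec_neq0 _)) //= leqnn.
Qed.

Lemma palg_nil A : mul_nil m.+2 (palg A).
Proof.
have [->|neA] : A = P0 \/ A <> P0 by case: A; (by left) || by right.
  by move=> x y; apply/colP => k; rewrite palg_P0 fil_iter // mxE.
by move=> x y; rewrite palg_qalg // iterS qalg_nil // /pmu bil0r.
Qed.

Lemma palg_corank2 A u : A <> P0 -> corank_alg A -> gorbit (palg A) u -> form_corank2 u.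
Proof.
move=> neA cA [g ug ->]; rewrite palg_qalg //.
have -> : (qpar A).1.1 = 0 by case: A neA cA.
move: (qpar A).1.2 (qpar A).2 => ga de.
apply: (@form_corank2_of_ann _ _ (g *m vec m.+1) (g *m vec m.+2)) => [y|y|c d].
- by rewrite -[y](mulKVmx ug) (pmu_act _ _ _ ug) qalg_vecm // mulmx0.
- by rewrite -[y](mulKVmx ug) (pmu_act _ _ _ ug) qalg_vecn mul0r scale0r mulmx0.
rewrite !scalemxAr -mulmxDr => /(congr1 (mulmx (invmx g))); rewrite mulKmx // mulmx0.
move=> /colP cd; have := cd ord_max; have := cd (inord m).
rewrite !mxE inordK // !eqxx !eqSS (ltn_eqF (ltnSn m)) (gtn_eqF (ltnSn m)) /= .
by rewrite !(mulr1, mulr0, addr0, add0r).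
Qed.

(** The form dual to [e_(n-1)] is antidiagonal on [e_1, ..., e_(n-2)] and has a 1 at [(n, n)]; a
    single 1 at [(n-1, n-1)], of rank one, turns it into the matrix of the involution [sg]. *)
Lemma palg_not_corank2 A : ~~ corank_alg A -> ~ form_corank2 (palg A).
Proof.
move=> cA; have neA : A <> P0 by case: A cA.
rewrite palg_qalg //; have -> : (qpar A).1.1 = 1 by case: A cA {neA}.
move: (qpar A).1.2 (qpar A).2 => ga de.
pose e : 'I_m.+2 := inord m.
have eE : e = m :> nat by rewrite inordK.
pose sg (j : 'I_m.+2) : 'I_m.+2 := if (j < m)%N then inord (m.-1 - j) else j.
pose f : 'rV[C]_m.+2 := delta_mx 0 e.
have fE (x : 'cV[C]_m.+2) : (f *m x) 0 0 = x e 0 by rewrite -rowE mxE.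
have sgE (j : 'I_m.+2) : sg j = (if (j < m)%N then (m.-1 - j)%N else j) :> nat.
  by rewrite /sg; case: ltnP => // _; rewrite inordK //; lia.
have AE i j : (mulform f (qalg m 1 ga de) + delta_mx e (0 : 'I_1) *m f) i j = (i == sg j)%:R.
  rewrite mul_delta_mx mxE [mulform _ _ _ _]mxE fE pmu_qalg mxE !ebas_vec fil_vec // scale_bool.
  rewrite (fun_if (fun x : 'cV[C]_m.+2 => x e 0)) !mxE -!(inj_eq val_inj) /= sgE eE.
  have lt_i := ltn_ord i; have lt_j := ltn_ord j.
  case: (leqP (i.+1 + j.+1)%N m.+1) => ?; case: (ltnP j m) => ?;
    repeat case: eqP => ?; first [by exfalso; lia | by rewrite /=; ring].
move=> /(_ f (delta_mx e 0) f) /eqP/det0P[v v0 /rowP vA]; case/eqP: v0; apply/rowP => i.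
have sgK : sg (sg i) = i.
  apply/val_inj; rewrite /= !sgE; case: (ltnP i m) => [lt_im|le_mi]; first by rewrite ifT; lia.
  by rewrite ltnNge le_mi.
have := vA (sg i); rewrite !mxE (bigD1 i) //= big1 ?addr0 => [|k ne_k].
  by rewrite AE sgK eqxx mulr1.
by rewrite AE sgK (negbTE ne_k) mulr0.
Qed.

(** The transitive closure of [listed] as a table, so that order statements are settled by
    computation. *)
Definition reach (A B : alg) : Prop :=
  match A, B with
  | P12, (P13 | P11) | P15, (P13 | P14 | P11) | P0, (P14 | P11) | P13, P11 | P14, P11 => True
  | _, _ => False
  end.

Lemma reach_trans_listed A B : reach A B -> clos_trans alg listed A B.
Proof.
by case: A; case: B => //= _; (by apply: t_step) || (by apply: (t_trans _ _ _ P13); apply: t_step)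
  || (by apply: (t_trans _ _ _ P14); apply: t_step).
Qed.

(** For every pair outside the table, one of the four closed conditions holds for [A] and fails for
    [B]. *)
Lemma degen_reach A B : A <> B -> degen (palg A) (palg B) -> reach A B.
Proof.
move=> neAB dAB.
have i0 : br_zero_alg A -> br_zero_alg B by move=> /br_zeroP/(degen_br_zero dAB)/br_zeroP.
have i1 : ad_sq_zero_alg A -> ad_sq_zero_alg B.
  by move=> /ad_sq_zeroP/(degen_ad_sq_zero dAB)/ad_sq_zeroP.
have i2 : nil_alg A -> nil_alg B by move=> /mul_nilP/(degen_mul_nil dAB)/mul_nilP.
have i3 : A <> P0 -> corank_alg A -> corank_alg B.
  move=> neA cA; apply: contraT => /palg_not_corank2; case.
  by apply: (degen_form_corank2 dAB) => u; apply: palg_corank2.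
case: A neAB {dAB} i0 i1 i2 i3; case: B => //= neAB i0 i1 i2 i3;
  by [have := i0 isT | have := i1 isT | have := i2 isT | have : false by apply: i3].
Qed.

Lemma listed_degen A B : listed A B -> degen (palg A) (palg B).
Proof.
have line (al ga de : C -> C) : B <> P0 -> qpar B = (al 0, ga 0, de 0) ->
    polyfun (fun x : {ffun unit -> C} => al (x tt)) ->
    polyfun (fun x : {ffun unit -> C} => ga (x tt)) ->
    polyfun (fun x : {ffun unit -> C} => de (x tt)) ->
    (forall t, t != 0 -> al t * de t = 0 /\ qnormal (al t) (ga t) (de t) = A) ->
    degen (palg A) (palg B).
  move=> neB BE pal pga pde AE; apply/degenP; rewrite [palg B]palg_qalg // BE.
  apply: (zclosure_curve (F := fun t => qalg m (al t) (ga t) (de t))) => [k|t t0].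
    exact: polyfun_qalg.
  by have [alde <-] := AE t t0; apply: qnormalP.
have pc c := polyfun_const (I := unit) c; have pt := polyfun_coord (I := unit) tt.
case: A line; case: B => //= line _.
- exact/degenP/P0_degen_P14.
(* The lines realize, in this order, [P12 -> P13], [P13 -> P11], [P14 -> P11], [P15 -> P13] and
   [P15 -> P14]. *)
- apply: (line (fun=> 0) (fun=> 1) id) => // t t0.
  by rewrite mul0r /qnormal eqxx t0.
- apply: (line (fun=> 0) id (fun=> 0)) => // t t0.
  by rewrite mul0r /qnormal eqxx t0.
- apply: (line id (fun=> 0) (fun=> 0)) => // t t0.
  by rewrite mulr0 /qnormal eqxx t0.
- apply: (line id (fun=> 1) (fun=> 0)) => // t t0.
  by rewrite mulr0 /qnormal oner_neq0 t0.
apply: (line (fun=> 1) id (fun=> 0)) => // t t0.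
by rewrite mulr0 /qnormal oner_neq0 t0.
Qed.

Lemma degen_palgP A B : A <> B -> (degen (palg A) (palg B) <-> clos_trans alg listed A B).
Proof.
move=> neAB; split=> [/(degen_reach neAB)/reach_trans_listed //|].
elim=> {neAB A B} [A B|A D B _ dAD _ dDB]; first exact: listed_degen.
exact: degen_trans dAD dDB.
Qed.

Lemma palg_iso A B : gorbit (palg A) (palg B) -> A = B.
Proof.
move=> gAB; apply: NNPP => neAB.
have := degen_reach neAB (iso_degen gAB).
have neBA : B <> A by move=> /esym.
have := degen_reach neBA (iso_degen (gorbit_sym gAB)).
by case: A {neAB neBA gAB}; case: B.
Qed.

Lemma palg_poisson A : is_poisson (palg A).
Proof.
have [->|neA] : A = P0 \/ A <> P0 by case: A; (by left) || by right.
  exact: fil_poisson.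
by rewrite palg_qalg //; apply: qalg_poisson => //; case: A neA => // _; rewrite ?mulr0 ?mul0r.
Qed.

(** Nonzero when [e_1], ..., [e_1^(n-1)], [e_n] is a basis for the product of [u]: an open condition
    satisfied by every [qalg], whose frame is the identity. *)
Definition frame_det (u : pstruct m.+2) : C := \det (frame (pw u (vec 1)) (vec m.+2)).

Lemma polyS_frame_det : polyS frame_det.
Proof.
apply: polyS_det => i j.
apply: (@eq_polyS _ (fun u => (if (j < m.+1)%N then pw u (vec 1) j else vec m.+2) i 0)).
  by move=> u; rewrite mxE.
case: ltnP => _; last exact: polyS_const.
by apply: polySV_iter; move=> k; apply: polyS_const.
Qed.

Lemma frame_det_qalg al ga de : frame_det (qalg m al ga de) != 0.
Proof.
rewrite -unitfE -unitmxE (_ : frame _ _ = 1%:M) ?unitmx1 //; apply/matrixP => i j.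
rewrite !mxE; case: ltnP => [lt_j|le_j].
  by rewrite -[vec 1]scale1r pw_qalg // expr1n scale1r mxE eqSS.
have -> : j = ord_max by apply/val_inj => /=; have := ltn_ord j; lia.
by rewrite mxE eqSS.
Qed.

(** An open and a closed condition enclose [u]. Since [B] lies in the closure of its orbit, some
    structure isomorphic to [u] inherits [frame_det != 0] from [B]; since [u] lies below [A], it
    inherits nilpotency. One of the two recognition lemmas then applies, according to whether
    [e_1^n] vanishes. *)
Lemma classification A B u : is_poisson u -> degen (palg A) u -> degen u (palg B) ->
  B <> P0 -> exists D, gorbit (palg D) u.
Proof.
move=> Pu dAu /degenP duB neB.
have [u' uu' Du'] : exists2 u', gorbit u u' & frame_det u' != 0.
  by apply: (zclosure_nonzero polyS_frame_det duB); rewrite palg_qalg // frame_det_qalg.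
have Pu' : is_poisson u' by case: uu' => g ug ->; apply: poisson_act.
have nil_u' : mul_nil m.+2 u'.
  exact: degen_mul_nil (degen_trans dAu (iso_degen uu')) (palg_nil A).
suff [D Du''] : exists D, gorbit (palg D) u'.
  by exists D; apply: (gorbit_trans Du''); apply: gorbit_sym.
have [pm|pm] := eqVneq (pw u' (vec 1) m.+1) 0; last first.
  exists P0; have [uf ->] := filalg_presentation Pu' pm (nil_u' _ _).
  by exists (frame (pw u' (vec 1)) (pw u' (vec 1) m.+1)).
have uf : frame (pw u' (vec 1)) (vec m.+2) \in unitmx by rewrite unitmxE unitfE.
have [b [al [ga [de [alde uf' ->]]]]] := qalg_recognition Pu' nil_u' pm m0 uf.
by exists (qnormal al ga de); apply: (gorbit_trans (qnormalP m1 _ alde)); eexists; first exact: uf'.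
Qed.

(** A pair of [reach] that is not listed ends at [P11] and factors through [P13] or [P14].
    Conversely an intermediate structure is one of the six, and no listed pair has one of them
    strictly in between. *)
Lemma primary_palgP A B : primary (palg A) (palg B) <-> listed A B.
Proof.
split=> [[dAB nAB no_u]|lAB].
  have neAB : A <> B by move=> eAB; apply: nAB; rewrite eAB; apply: gorbit_refl.
  have rAB := degen_reach neAB dAB.
  have mid D : listed A D -> listed D B -> False.
    move=> lAD lDB; apply: no_u; exists (palg D).
    split; [exact: palg_poisson|exact: listed_degen| |exact: listed_degen| ] => /palg_iso eq_alg.
      by case: A lAD eq_alg {dAB nAB neAB rAB}; case: D lDB.
    by case: B lDB eq_alg {dAB nAB neAB rAB}; case: D lAD.
  case: A {dAB nAB neAB no_u} rAB mid; case: B => //= _ mid;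
    by [case: (mid P13) | case: (mid P14)].
have neAB : A <> B by case: A lAB; case: B.
split; [exact: listed_degen|by move=> /palg_iso|].
move=> [u [Pu dAu nAu duB nuB]].
have neB : B <> P0 by case: A lAB {neAB dAu nAu}; case: B {duB nuB}.
have [D Du] := classification Pu dAu duB neB.
have rAD : reach A D.
  apply: degen_reach; first by move=> eAD; apply: nAu; rewrite eAD.
  exact: degen_trans dAu (iso_degen (gorbit_sym Du)).
have rDB : reach D B.
  apply: degen_reach; last exact: degen_trans (iso_degen Du) duB.
  by move=> eDB; apply: nuB; rewrite -eDB; apply: gorbit_sym.
by case: A lAB rAD {neAB dAu nAu}; case: B rDB {neB duB nuB}; case: D {Du}.
Qed.

End Classification.

(** * Dimensions of the orbit closures *)

Section UpperBounds.
Variable m : nat.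
Hypothesis m1 : (1 < m)%N.
Let m0 : (0 < m)%N := ltnW m1.
Local Notation n := m.+2.

Lemma eq_frame k (w w' : nat -> 'cV[C]_k.+1) y y' :
  (forall j, (j < k)%N -> w j = w' j) -> y = y' -> frame w y = frame w' y'.
Proof. by move=> eww ->; apply/matrixP => i j; rewrite !mxE; case: ltnP => // /eww ->. Qed.

(** Column 0 is the prescribed [v = e_1]; column [j.+1] is made of the parameters [x _ j], with 0
    beyond the range. *)
Definition wcol p (x : 'I_n -> 'I_p -> C) (k : nat) : 'cV[C]_n :=
  if k is j.+1 then \col_i (if insub j is Some j' then x i j' else 0) else vec 1.

Lemma wcolE p x (w : nat -> 'cV[C]_n) k : w 0%N = vec 1 ->
  (forall i (j : 'I_p), x i j = w j.+1 i 0) -> (k <= p)%N -> wcol x k = w k.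
Proof.
case: k => [|k] // _ xE lt_k; apply/colP => i; rewrite mxE.
by rewrite (insubT (fun j => (j < p)%N) lt_k) xE.
Qed.

Lemma polyfun_wcol (I : finType) p (x : {ffun I -> C} -> 'I_n -> 'I_p -> C) k i :
  (forall i j, polyfun (fun z => x z i j)) -> polyfun (fun z => wcol (x z) k i 0).
Proof.
move=> px; case: k => [|k]; first exact: polyfun_const.
apply: (@eq_polyfun _ (fun z => if insub k is Some j' then x z i j' else 0)).
  by move=> z; rewrite mxE.
by case: insubP => [j _ _|_] //; apply: polyfun_const.
Qed.

Lemma polyfun_frame (I : finType) (w : {ffun I -> C} -> nat -> 'cV[C]_n)
    (y : {ffun I -> C} -> 'cV[C]_n) :
  (forall k i, polyfun (fun z => w z k i 0)) -> (forall i, polyfun (fun z => y z i 0)) ->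
  forall i j, polyfun (fun z => frame (w z) (y z) i j).
Proof.
move=> pw py i j.
apply: (@eq_polyfun _ (fun z => (if (j < m.+1)%N then w z j else y z) i 0)).
  by move=> z; rewrite mxE.
by case: ltnP.
Qed.

(** On the dense part of the orbit where [e_1^n] has a nonzero last coordinate, the coordinates of
    [e_1^2], ..., [e_1^n] determine the structure. *)
Lemma P0_no_long_chain :
  ~ exists Z, irr_chain (zclosure (gorbit (palg n P0))) Z (n * m.+1).+1.
Proof.
pose I : finType := ('I_n * 'I_m.+1)%type.
pose w (z : {ffun I -> C}) := wcol (fun i j => z (i, j)).
pose M z := frame (w z) (w z m.+1).
have pw_w k i : polyfun (fun z => w z k i 0).
  by apply: polyfun_wcol => i' j; apply: polyfun_coord.
have pM : forall i j, polyfun (fun z => M z i j) by apply: polyfun_frame.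
apply: (@no_long_chain _ I (fun z => \det (M z)) (fun z => act (M z) (palg n P0))).
- exact: polyfun_det.
- by apply: reg_act => // k; apply: polyfun_const.
- apply: (gorbit_generic (D := fun u => pw u (vec 1) m.+1 ord_max 0) _ (gorbit_refl _)).
  + by apply: polySV_iter; apply: polySV_const.
  + by rewrite palg_P0 pw_fil // mxE eqxx oner_neq0.
  move=> u Pu Du; have poisson_u : is_poisson u.
    by case: Pu => g ug ->; apply: poisson_act => //; apply: palg_poisson.
  have pn0 : pw u (vec 1) m.+1 != 0 by apply: contraNneq Du => ->; rewrite mxE.
  have pn1 : pw u (vec 1) m.+2 = 0 by apply: (degen_mul_nil (iso_degen Pu) (palg_nil m1 P0)).
  have [ug uE] := filalg_presentation poisson_u pn0 pn1.
  pose x : {ffun I -> C} := [ffun p : I => pw u (vec 1) p.2.+1 p.1 0].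
  have Mx : M x = frame (pw u (vec 1)) (pw u (vec 1) m.+1).
    by apply: eq_frame => [j lt_j|]; (apply: wcolE; [by []|by move=> i j'; rewrite ffunE|by lia]).
  by exists x; rewrite Mx // -unitfE -unitmxE.
by rewrite card_prod !card_ord.
Qed.

(* The parameters: the columns 2 to [n - 1], the coefficients of the shift of
   the last column, and the two structure constants. *)
Lemma qalg_no_long_chain A (al ga de : C -> C -> C) : A <> P0 ->
  (forall (I : finType) (f g : {ffun I -> C} -> C), polyfun f -> polyfun g ->
     [/\ polyfun (fun z => al (f z) (g z)), polyfun (fun z => ga (f z) (g z)) &
         polyfun (fun z => de (f z) (g z))]) ->
  (forall al0 ga0 de0, al0 * de0 = 0 -> qnormal al0 ga0 de0 = A ->
     exists p q, [/\ al p q = al0, ga p q = ga0 & de p q = de0]) ->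
  ~ exists Z, irr_chain (zclosure (gorbit (palg n A))) Z (n * m.+1).+1.
Proof.
move=> neA pc cA; pose I : finType := ('I_n * 'I_m + 'I_m + bool)%type.
pose w (z : {ffun I -> C}) := wcol (fun i j => z (inl (inl (i, j)))).
pose y (z : {ffun I -> C}) := vec n + \sum_(j < m) z (inl (inr j)) *: w z j.
pose M z := frame (w z) (y z).
pose p (z : {ffun I -> C}) := z (inr true); pose q (z : {ffun I -> C}) := z (inr false).
pose Q z := qalg m (al (p z) (q z)) (ga (p z) (q z)) (de (p z) (q z)).
have pw_w k i : polyfun (fun z => w z k i 0).
  by apply: polyfun_wcol => i' j; apply: polyfun_coord.
have pM : forall i j, polyfun (fun z => M z i j).
  apply: polyfun_frame => // i.
  apply: (@eq_polyfun _ (fun z => vec n i 0 + \sum_(j < m) z (inl (inr j)) * w z j i 0)).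
    by move=> z; rewrite /y [RHS]mxE summxE; congr (_ + _); apply: eq_bigr => j _; rewrite [RHS]mxE.
  apply: polyfunD; first exact: polyfun_const.
  by apply: polyfun_sum => j; apply: polyfunM => //; apply: polyfun_coord.
apply: (@no_long_chain _ I (fun z => \det (M z)) (fun z => act (M z) (Q z))).
- exact: polyfun_det.
- apply: reg_act => // k.
  have [pal pga pde] := pc I p q (polyfun_coord _) (polyfun_coord _).
  exact: polyfun_qalg.
- apply: (gorbit_generic (polyS_frame_det m) (gorbit_refl _)).
    by rewrite palg_qalg // frame_det_qalg.
  move=> u Au Du; have poisson_u : is_poisson u.
    by case: Au => g ug ->; apply: poisson_act => //; apply: palg_poisson.
  have nil_u : mul_nil m.+2 u by apply: (degen_mul_nil (iso_degen Au) (palg_nil m1 A)).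
  have pm : pw u (vec 1) m.+1 = 0.
    have nilA : mul_nil m.+1 (palg n A) by apply/(mul_nilP m1); case: A neA {cA Au}.
    exact: (degen_mul_nil (iso_degen Au) nilA).
  have uf : frame (pw u (vec 1)) (vec n) \in unitmx by rewrite unitmxE unitfE.
  have [b [al0 [ga0 [de0 [alde uf' uE]]]]] := qalg_recognition poisson_u nil_u pm m0 uf.
  have nA : qnormal al0 ga0 de0 = A.
    apply: (palg_iso m1); apply: (gorbit_trans (qnormalP m1 _ alde)).
    by apply: (gorbit_trans _ (gorbit_sym Au)); rewrite uE; eexists; first exact: uf'.
  have [p0 [q0 [alE gaE deE]]] := cA _ _ _ alde nA.
  pose x : {ffun I -> C} := [ffun k : I => match k with
    | inl (inl (i, j)) => pw u (vec 1) j.+1 i 0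
    | inl (inr j) => b j
    | inr c => if c then p0 else q0 end].
  have wx k : (k <= m)%N -> w x k = pw u (vec 1) k.
    by apply: wcolE => // i j; rewrite ffunE.
  have Mx : M x = frame (pw u (vec 1)) (vec n + \sum_(j < m) b j *: pw u (vec 1) j).
    apply: eq_frame => [j lt_j|]; first exact: wx.
    by congr (_ + _); apply: eq_bigr => j _; rewrite ffunE wx // ltnW.
  exists x; first by rewrite Mx -unitfE -unitmxE.
  by rewrite Mx /Q /p /q !ffunE alE gaE deE.
rewrite !card_sum card_prod card_bool !card_ord; lia.
Qed.

(** The normal form [P12] forces [al = 0], leaving [ga] and [de] free; for [P15] below, [al != 0]
    forces [de = 0]. Either way two structure constants are left. *)
Lemma P12_no_long_chain :
  ~ exists Z, irr_chain (zclosure (gorbit (palg n P12))) Z (n * m.+1).+1.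
Proof.
apply: (@qalg_no_long_chain _ (fun _ _ => 0) (fun p _ => p) (fun _ q => q)) => //.
  by move=> I f g pf pg; split=> //; apply: polyfun_const.
move=> al ga de _; rewrite /qnormal; have [-> _|_] := eqVneq al 0; first by exists ga, de.
by case: ifP.
Qed.

Lemma P15_no_long_chain :
  ~ exists Z, irr_chain (zclosure (gorbit (palg n P15))) Z (n * m.+1).+1.
Proof.
apply: (@qalg_no_long_chain _ (fun p _ => p) (fun _ q => q) (fun _ _ => 0)) => //.
  by move=> I f g pf pg; split=> //; apply: polyfun_const.
move=> al ga de /eqP; rewrite mulf_eq0 /qnormal; have [_ _|_ /eqP -> _] := eqVneq al 0.
  by do !case: ifP.
by exists al, ga.
Qed.

End UpperBounds.

(** * A chain of length n^2 - n - 2 in the orbit closure of [P11] *)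

Section LowerBound.

(** For [a = b] the matrix has a diagonal entry 2, which is nonzero in characteristic zero. *)
Lemma unit_1_delta n (a b : 'I_n) : 1%:M + delta_mx a b \in @unitmx C n.
Proof.
rewrite unitmxE unitfE; apply/negP => /det0P[v v0].
rewrite mulmxDr mulmx1 => /rowP vE; case/eqP: v0.
have vE' j : v 0 j + v 0 a * (j == b)%:R = 0.
  have := vE j; rewrite !mxE (bigD1 a) //= big1 ?addr0 => [|k ne_k]; first by rewrite mxE eqxx.
  by rewrite mxE (negbTE ne_k) mulr0.
have v_off j : j != b -> v 0 j = 0.
  by move=> /negbTE ne_j; have := vE' j; rewrite ne_j mulr0 addr0.
apply/rowP => j; rewrite [RHS]mxE; have [->|] := eqVneq j b; last exact: v_off.
have := vE' b; rewrite eqxx mulr1; have [->|/v_off ->] := eqVneq a b; last by rewrite addr0.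
by move/eqP; rewrite -mulr2n -mulr_natr mulf_eq0 natC_eq0 orbF => /eqP.
Qed.

Definition id_off n (ps : seq ('I_n * 'I_n)) (g : 'M[C]_n) :=
  forall i j, (i, j) \notin ps -> g i j = (i == j)%:R.

Lemma id_off_1_delta n ps (a b : 'I_n) : (a, b) \in ps -> id_off ps (1%:M + delta_mx a b).
Proof.
move=> ab_ps i j ij_ps; rewrite !mxE [X in _ + X](_ : _ = 0) ?addr0 //.
case: eqP => // ei; case: eqP => //= ej.
by rewrite ei ej ab_ps in ij_ps.
Qed.

(* The closed sets of the chain are obtained by freeing one matrix entry at a time. *)
Lemma chain_of_positions n (s : pstruct n) (ps : seq ('I_n * 'I_n)) p0 : uniq ps ->
  (forall k (p := nth p0 ps k), (k < size ps)%N -> exists q e, [/\ polyS q, e != 0 &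
     forall g, g \in unitmx -> id_off (take k.+1 ps) g -> q (act g s) = e * g p.1 p.2]) ->
  exists Z, irr_chain (zclosure (gorbit s)) Z (size ps).
Proof.
move=> uniq_ps psE; pose I : finType := ('I_n * 'I_n)%type.
pose M k (x : {ffun I -> C}) : 'M[C]_n :=
  \matrix_(i, j) if (i, j) \in take k ps then x (i, j) else (i == j)%:R.
have pM k i j : polyfun (fun x : {ffun I -> C} => M k x i j).
  apply: (@eq_polyfun _ (fun x : {ffun I -> C} =>
    if (i, j) \in take k ps then x (i, j) else (i == j)%:R)) => [x|]; first by rewrite mxE.
  by case: ((i, j) \in take k ps); [apply: polyfun_coord|apply: polyfun_const].
pose T k t := exists2 x, \det (M k x) != 0 & t = act (M k x) s.
have TP k t : T k t <-> exists2 g, g \in unitmx /\ id_off (take k ps) g & t = act g s.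
  split=> [[x dx ->]|[g [ug gid] ->]].
    exists (M k x) => //; rewrite unitmxE unitfE; split=> // i j /negbTE ij.
    by rewrite mxE ij.
  have Mg : M k [ffun p => g p.1 p.2] = g.
    by apply/matrixP => i j; rewrite mxE ffunE /=; case: ifP => // /negbT/gid.
  by exists [ffun p => g p.1 p.2]; rewrite Mg // -unitfE -unitmxE.
exists (fun k => zclosure (T k)); split=> k.
  move=> _; split.
    apply: (@irreducible_param n I _ _ [ffun p => (p.1 == p.2)%:R]).
    - exact: polyfun_det (pM k).
    - by apply: reg_act (pM k) _ => l; apply: polyfun_const.
    - rewrite (_ : M k _ = 1%:M) ?det1 ?oner_neq0 //.
      by apply/matrixP => i j; rewrite !mxE ffunE /= if_same.
  by move=> t; apply: zclosure_sub => u /TP[g [ug _] ->]; apply: sub_zclosure; exists g.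
move=> lt_k; have [q [e [pq e0 qE]]] := psE k lt_k; set p := nth p0 ps k in qE.
have takeS : take k.+1 ps = rcons (take k ps) p by apply: take_nth.
have pk : p \notin take k ps.
  by have := take_uniq k.+1 uniq_ps; rewrite takeS rcons_uniq => /andP[].
have id_offS h : id_off (take k ps) h -> id_off (take k.+1 ps) h.
  by move=> hid i j ij; apply: hid; apply: contra ij; rewrite takeS mem_rcons inE orbC => ->.
(* While [p] is frozen its entry is that of the identity, so [q] is constant on the smaller set;
   once [p] is free, adding 1 to that entry changes the value. *)
pose c := e * (p.1 == p.2)%:R.
have qc h : h \in unitmx -> id_off (take k ps) h -> q (act h s) = c.
  by move=> uh hid; rewrite (qE _ uh (id_offS _ hid)) hid // -surjective_pairing.
have [g [ug gid gq]] : exists g, [/\ g \in unitmx, id_off (take k.+1 ps) g & q (act g s) != c].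
  exists (1%:M + delta_mx p.1 p.2); have uid := unit_1_delta p.1 p.2.
  have idp : id_off (take k.+1 ps) (1%:M + delta_mx p.1 p.2).
    by apply: id_off_1_delta; rewrite takeS mem_rcons inE -surjective_pairing eqxx.
  split=> //; rewrite qE // -subr_eq0 -mulrBr !mxE !eqxx addrAC subrr add0r.
  by rewrite mulf_neq0 // oner_neq0.
split=> [t|sZ].
  apply: zclosure_sub => u /TP[h [uh hid] ->]; apply/sub_zclosure/TP; exists h => //.
  by split=> //; apply: id_offS.
have : zclosure (T k) (act g s) by apply/sZ/sub_zclosure/TP; exists g.
move/(zclosure_polyS (F := fun u => q u + - c)) => qg.
have /eqP : q (act g s) + - c = 0.
  apply: qg => [|u /TP[h [uh hid] ->]]; last by rewrite qc // subrr.
  by apply: polySD pq _; apply: polyS_const.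
by rewrite subr_eq0 (negbTE gq).
Qed.

Variable m : nat.
Hypothesis m1 : (1 < m)%N.
Let m0 : (0 < m)%N := ltnW m1.
Local Notation n := m.+2.
Local Notation s := (qalg m 0 0 0).

(** The last two entries of the last column stay frozen: [e_(n-1)] and [e_n] are both killed by
    [e_1], so multiplication by [e_1] cannot detect them. *)
Definition last_col_pos : seq ('I_n * 'I_n) := [seq (inord j, ord_max) | j <- iota 0 m].
Definition mid_col_pos : seq ('I_n * 'I_n) :=
  [seq (i, inord j) | j <- iota 1 m, i <- enum 'I_n].

Lemma size_last_col_pos : size last_col_pos = m.
Proof. by rewrite size_map size_iota. Qed.

Lemma last_col_posP i j : (i, j) \in last_col_pos -> j = ord_max /\ (i < m)%N.
Proof.
case/mapP => k; rewrite mem_iota add0n => /= lt_k [-> ->].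
by rewrite inordK ?leqW.
Qed.

Lemma mid_col_posP i j : (i, j) \in mid_col_pos = (0 < j < m.+1)%N.
Proof.
apply/allpairsP/idP => [[[k i'] /= []]|/andP[j0 lt_j]].
  rewrite mem_iota add1n => /andP[k0 lt_k] _ [_ ->].
  by rewrite inordK ?k0 ?lt_k // leqW.
by exists (j : nat, i); rewrite mem_enum mem_iota j0 add1n lt_j inord_val.
Qed.

Lemma uniq_pos : uniq (last_col_pos ++ mid_col_pos).
Proof.
rewrite cat_uniq; apply/and3P; split.
- rewrite map_inj_in_uniq ?iota_uniq // => j j'; rewrite !mem_iota !add0n => /= lt_j lt_j' [].
  by by move/(congr1 val); rewrite /= !inordK ?leqW.
- apply/hasPn => -[i j]; rewrite mid_col_posP => /andP[_ lt_j].
  by apply: contraL lt_j => /last_col_posP[-> _]; rewrite /= ltnn.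
apply: allpairs_uniq; rewrite ?iota_uniq ?enum_uniq //.
move=> [k i] [k' i'] /allpairsP[[a b] /= [+ _ [-> ->]]] /allpairsP[[a' b'] /= [+ _ [-> ->]]] [->].
rewrite !mem_iota !add1n => /andP[_ lt_a] /andP[_ lt_a'] /(congr1 val).
by rewrite /= (inordK (leqW lt_a)) (inordK (leqW lt_a')) => ->.
Qed.

Lemma qalg0_chain : exists Z, irr_chain (zclosure (gorbit s)) Z (m + m * n).
Proof.
have szE : (m + m * n)%N = size (last_col_pos ++ mid_col_pos).
  by rewrite size_cat size_last_col_pos size_allpairs size_iota size_enum_ord.
rewrite szE; apply: (chain_of_positions (p0 := (0, 0))); first exact: uniq_pos.
move=> k p lt_k; set ps := _ ++ _ in p lt_k *.
have col0 (g : 'M[C]_n) : id_off (take k.+1 ps) g -> g *m vec 1 = vec 1.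
  move=> gid; apply/colP => i; rewrite -(ebas_vec (0 : 'I_n)) -colE !mxE gid ?andbT //.
  apply/negP => /mem_take; rewrite mem_cat mid_col_posP andFb orbF.
  by move=> /last_col_posP[].
have [lt_km|le_mk] := ltnP k m; last first.
  have : p \in mid_col_pos.
    rewrite /p nth_cat size_last_col_pos ltnNge le_mk mem_nth // ltn_subLR //.
    by move: lt_k; rewrite size_cat size_last_col_pos.
  case: p => i j; rewrite mid_col_posP => /andP[j0 lt_j].
  exists (fun u => pw u (vec 1) j i 0), 1; split; first by apply: polySV_iter; apply: polySV_const.
    exact: oner_neq0.
  move=> g ug gid; rewrite mul1r -[vec 1](col0 g gid) /pw iter_act // -/(pw _ _ _).
  rewrite -[vec 1]scale1r pw_qalg // expr1n scale1r -ebas_vec -colE mxE.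
  by [].
have pE : p = (inord k, ord_max).
  by rewrite /p nth_cat size_last_col_pos lt_km (nth_map 0%N) ?size_iota // nth_iota.
(* In [act g s] the product of [e_1] and [g e_n] is zero, so [e_1 e_n] is minus the sum of the
   [g_(i,n) e_1 e_i], and [e_1] shifts the index by one: hence the coordinate [k.+1] and the
   sign. *)
exists (fun u => pmu u (vec 1) (vec n) (inord k.+1) 0), (-1); split.
- by apply: polySV_bil; apply: polySV_const.
- by rewrite oppr_eq0 oner_neq0.
move=> g ug gid; rewrite pE /= mulN1r.
have take_last i j : (i, j) \in take k.+1 ps -> j = ord_max /\ (i < m)%N.
  rewrite /ps takel_cat ?size_last_col_pos // => /mem_take; exact: last_col_posP.
have gcol (i : 'I_n) : (i < m.+1)%N -> g *m ebas i = ebas i.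
  move=> lt_i; apply/colP => l; rewrite -colE !mxE gid ?andbT //.
  by apply/negP => /take_last[ei _]; rewrite ei /= ltnn in lt_i.
have gmul (i : 'I_n) : (i < m.+1)%N ->
    pmu (act g s) (vec 1) (ebas i) = (i < m)%N%:R *: vec i.+2.
  move=> lt_i; rewrite -{1}(col0 g gid) -{1}(gcol i lt_i) pmu_act // ebas_vec qalg_vec //.
  rewrite add1n ltnS !scale_bool; case: ifP => [lt_im|_]; last exact: mulmx0.
  have lt_i1 : (i.+1 < n)%N by rewrite ltnS leqW.
  by rewrite -(ebas_vec (Ordinal lt_i1)) gcol.
have gn0 : pmu (act g s) (vec 1) (g *m ebas ord_max) = 0.
  by rewrite -{1}(col0 g gid) pmu_act // ebas_vec qalgC qalg_vecn mul0r scale0r mulmx0.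
have gmax : g *m ebas ord_max = \sum_(i < m.+1)
    g (widen_ord (leqnSn _) i) ord_max *: ebas (widen_ord (leqnSn _) i) + vec n.
  rewrite [LHS]col_sum_ebas big_ord_recr /=; congr (_ + _).
    by apply: eq_bigr => i _; rewrite -colE mxE.
  rewrite -colE mxE gid ?eqxx; first by rewrite ebas_vec scale1r.
  by apply/negP => /take_last[_] /=; rewrite ltnNge leqnSn.
move: gn0; rewrite gmax pmuDr /pmu bil_sumr -/(pmu _ _ _) => /eqP.
rewrite addrC addr_eq0 => /eqP ->.
rewrite mxE summxE; congr (- _).
have lt_k1 : (k < m.+1)%N := leqW lt_km.
rewrite (bigD1 (Ordinal lt_k1)) //= big1 ?addr0 => [|i ne_i].
  rewrite bilZr -/(pmu _ _ _) gmul // lt_km scale_bool !mxE inordK // eqxx [true%:R]/(1 : C) mulr1.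
  by congr (g _ _); apply/val_inj; rewrite /= inordK // leqW.
rewrite bilZr -/(pmu _ _ _) (gmul (widen_ord _ i) (ltn_ord i)) scale_bool mxE.
case: ifP => _; last by rewrite mxE mulr0.
rewrite mxE inordK // !eqSS (_ : (k == i :> nat) = false) ?mulr0 //.
by apply: contraNF ne_i => /eqP eki; apply/eqP/val_inj.
Qed.

End LowerBound.

(** * Comparison of dimensions along degenerations, and conclusion *)

Lemma degen_strict m A B : (1 < m)%N -> reach A B ->
  (forall t, zclosure (gorbit (palg m.+2 B)) t -> zclosure (gorbit (palg m.+2 A)) t) /\
  exists2 t, zclosure (gorbit (palg m.+2 A)) t & ~ zclosure (gorbit (palg m.+2 B)) t.
Proof.
move=> m1 rAB; have neAB : A <> B by case: A rAB; case: B.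
have dAB : degen (palg m.+2 A) (palg m.+2 B).
  by apply/(degen_palgP m1 neAB)/reach_trans_listed.
split=> [t|]; first by apply: zclosure_gorbit_trans; apply/degenP.
exists (palg m.+2 A); first exact/sub_zclosure/gorbit_refl.
move=> /degenP dBA; have neBA : B <> A by move=> /esym.
by have := degen_reach m1 neBA dBA; case: A rAB {neAB dAB dBA neBA}; case: B.
Qed.

Lemma palg_chain_up m A B k : (1 < m)%N -> reach A B ->
  (exists Z, irr_chain (zclosure (gorbit (palg m.+2 B))) Z k) ->
  exists Z, irr_chain (zclosure (gorbit (palg m.+2 A))) Z k.+1.
Proof.
move=> m1 rAB [Z chZ]; have [sBA tA] := degen_strict m1 rAB.
exact: irr_chain_extend (irreducible_gorbit _) sBA tA chZ.
Qed.

Theorem theorem5p3 (n : nat) (hn : (3 < n)%N) :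
  (forall A : alg, is_poisson (palg n A)) /\
  (has_dim (gorbit (palg n P0)) (n ^ 2 - n) /\
   has_dim (gorbit (palg n P12)) (n ^ 2 - n) /\
   has_dim (gorbit (palg n P15)) (n ^ 2 - n) /\
   has_dim (gorbit (palg n P13)) (n ^ 2 - n - 1) /\
   has_dim (gorbit (palg n P14)) (n ^ 2 - n - 1) /\
   has_dim (gorbit (palg n P11)) (n ^ 2 - n - 2)) /\
  (forall A B : alg, primary (palg n A) (palg n B) <-> listed A B) /\
  ~ degen (palg n P0) (palg n P13) /\
  ~ degen (palg n P12) (palg n P14) /\
  (forall A B : alg, A <> B ->
     (degen (palg n A) (palg n B) <-> clos_trans alg listed A B)).
Proof.
case: n hn => [|[|m]] // m1.
have up A B k := @palg_chain_up m A B k m1.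
have P11_chain : exists Z, irr_chain (zclosure (gorbit (palg m.+2 P11))) Z (m + m * m.+2).
  by rewrite palg_qalg //; apply: qalg0_chain.
have P13_chain := up P13 P11 _ I P11_chain; have P14_chain := up P14 P11 _ I P11_chain.
(* With [n = m + 2] the chain for [P11] has length n^2 - n - 2, and the length n (n - 1) + 1
   excluded for the maximal algebras exceeds it by three. *)
have dE : (m.+2 ^ 2 - m.+2 = (m + m * m.+2).+2)%N by lia.
have dE' : (m + m * m.+2).+3 = (m.+2 * m.+1).+1 by lia.
have no12 := P12_no_long_chain m1; have no15 := P15_no_long_chain m1.
have no0 := P0_no_long_chain m1; rewrite -dE' in no0 no12 no15.
split; first exact: palg_poisson.
split; last first.
  split; first by move=> A B; apply: primary_palgP.
  split; first by move/(degen_reach m1) => H; apply: H.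
  split; first by move/(degen_reach m1) => H; apply: H.
  by move=> A B; apply: degen_palgP.
rewrite dE !subSS !subn0; split; [|split; [|split; [|split; [|split]]]]; split=> //.
- exact: up P0 P14 _ I P14_chain.
- exact: up P12 P13 _ I P13_chain.
- exact: up P15 P13 _ I P13_chain.
(* Upper bounds below the maximal algebras: a chain that is too long would extend to one that is too
   long in the closure of [P12] or [P0]. *)
- by move=> ch13; apply/no12/(up P12 P13 _ I ch13).
- by move=> ch14; apply/no0/(up P0 P14 _ I ch14).
by move=> ch11; apply/no12/(up P12 P13 _ I)/(up P13 P11 _ I ch11).
Qed.
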